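(* Let $T>0$, $\chi(0)\in\ell^\infty(\mathbf{C}^r)$ and $\gamma\in L^\infty([0,T],\ell^\infty(\mathbf{C}^r))$. Consider the comparison equation, for non-negative real functions $\tilde\chi_{\mathbf k}(t)$, $$\dot{\tilde\chi}_{\mathbf k}=\lambda_{\mathbf k}\Big[-\tilde\chi_{\mathbf k}+C_fp_{\mathbf k}\tilde\chi_{\mathbf k}+C_b\sum_{\mathbf l,\mathbf m\in\mathbf{Z}^d}q_{\mathbf k,\mathbf l,\mathbf m}\tilde\chi_{\mathbf l}\tilde\chi_{\mathbf m}+d_{\mathbf k}|\gamma_{\mathbf k}|\Big],\qquad\tilde\chi_{\mathbf k}(0)=|\chi_{\mathbf k}(0)|,\qquad\mathbf k\in\mathbf{Z}^d.\tag{C}$$ (1) If the expectations $\mathsf E_{\mathbf k}[\tilde R_t]$ are finite for all $t\in[0,T]$ and $\mathbf k\in\mathbf{Z}^d$, then $\tilde\chi_{\mathbf k}(t)=\mathsf E_{\mathbf k}[\tilde R_t]$ defines a mild solution of (C) for which $t\mapsto\tilde\chi_{\mathbf k}(t)$ is continuous on $[0,T]$ (for each $\mathbf k$). (2) Conversely, if there exists a finite (non-negative) mild solution of (C), that is one with $\tilde\chi_{\mathbf k}(t)<\infty$ for all $t\in[0,T]$ and $\mathbf k\in\mathbf{Z}^d$, then the expectations $\mathsf E_{\mathbf k}[\tilde R_t]$ are finite for all $t\in[0,T]$ and $\mathbf k\in\mathbf{Z}^d$, and they define the smallest non-negative mild solution of (C). (3) The comparison $\mathsf E_{\mathbf k}[|R_t|]\le\mathsf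 E_{\mathbf k}[\tilde R_t]$ holds, with equality whenever $|B_{\mathbf k,\mathbf l,\mathbf m}(\chi,\chi')|=|\chi||\chi'|$ for all $\mathbf k,\mathbf l,\mathbf m$ and all $\chi,\chi'\in\mathbf{C}^r$.
   Context: **Constants.** Fix integers $d,r\ge1$. For $\mathbf k,\mathbf l,\mathbf m\in\mathbf{Z}^d$ fix constants $\lambda_{\mathbf k}>0$ and $p_{\mathbf k},q_{\mathbf k,\mathbf l,\mathbf m},d_{\mathbf k}\in[0,1]$, constants $C_f,C_b\ge0$, and bilinear maps $B_{\mathbf k,\mathbf l,\mathbf m}:\mathbf{C}^r\times\mathbf{C}^r\to\mathbf{C}^r$ with $|B_{\mathbf k,\mathbf l,\mathbf m}(\chi,\chi')|\le|\chi|\,|\chi'|$, where $|\cdot|$ is the Euclidean norm on $\mathbf{C}^r$. Put $q_{\mathbf k}=\sum_{\mathbf l,\mathbf m}q_{\mathbf k,\mathbf l,\mathbf m}$. Standing assumptions: $p_{\mathbf k}+q_{\mathbf k}+d_{\mathbf k}=1$ for all $\mathbf k$, and $p_{\mathbf k}\to0$, $q_{\mathbf k}\to0$ as $|\mathbf k|\to\infty$. $\ell^\infty(\mathbf{C}^r)$ is the space of bounded families $(a_{\mathbf k})_{\mathbf k\in\mathbf{Z}^d}$ in $\mathbf{C}^r$ with the supremum norm. Data: initial condition $\chi(0)=(\chi_{\mathbf k}(0))$ and forcing $\gamma=(\gamma_{\mathbf k}(t))$. A mild solution of (C) on $[0,T]$ is a family of measurable $\tilde\chi_{\mathbf k}:[0,T]\to[0,\infty)$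 (not required to be bounded in $\mathbf k$) with, for all $\mathbf k$ and $t\in[0,T]$, $$\tilde\chi_{\mathbf k}(t)=e^{-\lambda_{\mathbf k}t}|\chi_{\mathbf k}(0)|+\int_0^t\lambda_{\mathbf k}e^{-\lambda_{\mathbf k}(t-s)}\Big[C_fp_{\mathbf k}\tilde\chi_{\mathbf k}(s)+C_b\sum_{\mathbf l,\mathbf m}q_{\mathbf k,\mathbf l,\mathbf m}\tilde\chi_{\mathbf l}(s)\tilde\chi_{\mathbf m}(s)+d_{\mathbf k}|\gamma_{\mathbf k}(s)|\Big]ds.$$ **Branching tree.** Let $\mathscr{I}=\bigcup_{n\ge0}\{0,1,2\}^n$ be the set of labels, $\emptyset$ the label of length $0$; for a label $\alpha=(\alpha_1,\dots,\alpha_n)$ write $|\alpha|=n$, $\alpha|_j=(\alpha_1,\dots,\alpha_j)$, and $(\alpha,i)$, $(i,\alpha)$ for the labels obtained by appending, prepending $i\in\{0,1,2\}$. Take independent families of independent variables: $(E_\alpha)_{\alpha\in\mathscr I}$ exponential of mean one; $(U_\alpha)_{\alpha\in\mathscr I}$ uniform on $[0,1]$; and pairs $(Y^{(1)}_\alpha(\mathbf k),Y^{(2)}_\alpha(\mathbf k))$, $\alpha\in\mathscr I$, $\mathbf k\in\mathbf{Z}^d$, with $P[Y^{(1)}_\alpha(\mathbf k)=\mathbf l,Y^{(2)}_\alpha(\mathbf k)=\mathbf m]=q_{\mathbf k,\mathbf l,\mathbf m}/q_{\mathbf k}$ if $q_{\mathbf k}>0$ (arbitrary law if $q_{\mathbf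 k}=0$). Fix $\mathbf k\in\mathbf{Z}^d$ and set $\hat{\mathbf K}_\emptyset=\mathbf k$, $\tau^B_\emptyset=0$, $\tau^D_\emptyset=\lambda_{\mathbf k}^{-1}E_\emptyset$, $I_\emptyset=1$. Inductively, for $\beta\in\mathscr I$ and $i\in\{0,1,2\}$: $\hat{\mathbf K}_{(\beta,0)}=\hat{\mathbf K}_\beta$, $\hat{\mathbf K}_{(\beta,i)}=Y^{(i)}_\beta(\hat{\mathbf K}_\beta)$ for $i=1,2$; $\tau^B_{(\beta,i)}=\tau^D_\beta$, $\tau^D_{(\beta,i)}=\tau^B_{(\beta,i)}+\lambda^{-1}_{\hat{\mathbf K}_{(\beta,i)}}E_{(\beta,i)}$; $I_{(\beta,0)}=1$ if $U_\beta\in[0,p_{\hat{\mathbf K}_\beta}]$ and $0$ otherwise; for $i=1,2$, $I_{(\beta,i)}=1$ if $U_\beta\in[1-q_{\hat{\mathbf K}_\beta},1]$ and $0$ otherwise. With an isolated cemetery state $\Delta$, set $\mathbf K_\alpha=\hat{\mathbf K}_\alpha$ if $\prod_{j=1}^{|\alpha|}I_{\alpha|_j}=1$ and $\mathbf K_\alpha=\Delta$ otherwise. The branching tree rooted at $\mathbf k$ is $\mathcal T_{\mathbf k}=(\mathbf K_\alpha,\tau^B_\alpha,\tau^D_\alpha)_{\alpha\in\mathscr I}$; $\mathsf P_{\mathbf k}$ denotes its law and $\mathsf E_{\mathbf k}$ the corresponding expectation. For a tree $\mathcal T=(\mathbf k_\alpha,s_\alpha,t_\alpha)_{\alpha\in\mathscr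 I}$ let $\pi_i(\mathcal T)=(\mathbf k_{(i,\alpha)},s_{(i,\alpha)}-t_\emptyset,t_{(i,\alpha)}-t_\emptyset)_{\alpha\in\mathscr I}$, $i=0,1,2$, and let $N_{[0,t]}(\mathcal T)$ be the number of $\alpha\in\mathscr I$ with $\mathbf k_\alpha\ne\Delta$ and $s_\alpha\le t$; $N_{[0,t]}<\infty$ holds $\mathsf P_{\mathbf k}$-a.s. for all $t\geq 0$. There is a death at $\emptyset$ if $\mathbf k_{(0)}=\mathbf k_{(1)}=\mathbf k_{(2)}=\Delta$; a flip at $\emptyset$ if $\mathbf k_{(0)}\ne\Delta$, $\mathbf k_{(1)}=\mathbf k_{(2)}=\Delta$; a branch at $\emptyset$ if $\mathbf k_{(0)}=\Delta$ and $\mathbf k_{(1)},\mathbf k_{(2)}\ne\Delta$; $\mathsf P_{\mathbf k}$-a.s. exactly one of these occurs. **Evaluations.** The maps $R_t$, $t\ge0$, from trees to $\mathbf{C}^r$ are determined, on trees with $N_{[0,t]}(\mathcal T)<\infty$, by the (terminating) recursion: $R_t(\mathcal T)=\chi_{\mathbf k_\emptyset}(0)$ if $t_\emptyset\ge t$; and if $t_\emptyset<t$: $R_t(\mathcal T)=\gamma_{\mathbf k_\emptyset}(t-t_\emptyset)$ for a death at $\emptyset$; $R_t(\mathcal T)=C_fR_{t-t_\emptyset}(\pi_0(\mathcal T))$ for a flip at $\emptyset$; $R_t(\mathcal T)=C_bB_{\mathbf k_\emptyset,\mathbf k_{(1)},\mathbf k_{(2)}}(R_{t-t_\emptyset}(\pi_1(\mathcal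 T)),R_{t-t_\emptyset}(\pi_2(\mathcal T)))$ for a branch at $\emptyset$. The maps $\tilde R_t$, with values in $[0,\infty)$, are determined by the same recursion with $\chi(0)$, $\gamma$ replaced by $(|\chi_{\mathbf k}(0)|)$, $(|\gamma_{\mathbf k}|)$ and each $B_{\mathbf k,\mathbf l,\mathbf m}$ replaced by the product of real numbers. *)

(* Defs.v *)
From HB Require Import structures.
From mathcomp Require Import all_boot all_order all_algebra.
From mathcomp Require Import all_classical all_reals all_analysis.
From mathcomp Require Import complex.

Set Implicit Arguments.
Unset Strict Implicit.
Unset Printing Implicit Defensive.

Import Order.TTheory GRing.Theory Num.Theory.
Import numFieldNormedType.Exports.

Local Open Scope classical_set_scope.
Local Open Scope ring_scope.

Notation Zd d := ('rV[int]_d).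
Notation Cr R r := ('cV[R[i]]_r).

Section norms.
Context {R : realType}.

Definition znorm (d : nat) (k : Zd d) : R :=
  Num.sqrt (\sum_(i < d) (k 0 i)%:~R ^+ 2).

(* The norm that mathcomp-analysis puts on matrices is the supremum norm, hence
   this explicit Euclidean one. *)
Definition cnorm (r : nat) (v : Cr R r) : R :=
  Num.sqrt (\sum_(i < r) (complex.Re (v i 0) ^+ 2 + complex.Im (v i 0) ^+ 2)).

Definition vanishes_at_infinity (d : nat) (f : Zd d -> R) : Prop :=
  forall e : R, 0 < e -> exists M : R, forall k, M < znorm k -> `|f k| < e.

End norms.

Section constants.
Context {R : realType} {d r : nat}.

Record constants := Constants {
  lambda : Zd d -> R;
  pflip : Zd d -> R;
  qbranch : Zd d -> Zd d -> Zd d -> R;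
  pdeath : Zd d -> R;
  Cflip : R;
  Cbranch : R;
  Bmap : Zd d -> Zd d -> Zd d -> {bilinear Cr R r -> Cr R r -> Cr R r} }.

Variable c : constants.

Definition qtotal (k : Zd d) : \bar R :=
  (\esum_(lm in [set: Zd d * Zd d]) (qbranch c k lm.1 lm.2)%:E)%E.

Definition qsum (k : Zd d) : R := fine (qtotal k).

(* The equation p + q + d = 1 is stated in \bar R, so that it forces [qtotal] to
   be finite and [qsum] to be the actual sum. *)
Record standing_assumptions : Prop := StandingAssumptions {
  lambda_gt0 : forall k, 0 < lambda c k;
  pflip_01 : forall k, 0 <= pflip c k <= 1;
  qbranch_01 : forall k l m, 0 <= qbranch c k l m <= 1;
  pdeath_01 : forall k, 0 <= pdeath c k <= 1;
  Cflip_ge0 : 0 <= Cflip c;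
  Cbranch_ge0 : 0 <= Cbranch c;
  Bmap_bound : forall k l m u v,
    cnorm (Bmap c k l m u v) <= cnorm u * cnorm v;
  pqd_sum1 : forall k,
    ((pflip c k)%:E + qtotal k + (pdeath c k)%:E = 1)%E;
  pflip_vanishes : vanishes_at_infinity (pflip c);
  qsum_vanishes : vanishes_at_infinity qsum }.

Definition in_linfty (chi0 : Zd d -> Cr R r) : Prop :=
  exists M : R, forall k, cnorm (chi0 k) <= M.

(* The measurability of an l^infty-valued function is componentwise (weak-star)
   measurability.  The values outside [0, T] are never used. *)
Definition in_Linfty_linfty (T : R) (gamma : Zd d -> R -> Cr R r) : Prop :=
  (forall k i,
     measurable_fun `[0, T] (fun t => complex.Re (gamma k t i 0)) /\
     measurable_fun `[0, T] (fun t => complex.Im (gamma k t i 0))) /\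
  exists M : R, {ae (@lebesgue_measure R), forall t : R, 0 <= t <= T ->
    forall k, cnorm (gamma k t) <= M}.

(* All the terms are nonnegative, so the equation makes sense in \bar R, with
   the usual convention 0 * +oo = 0; its left-hand side being finite, it says in
   particular that the integral converges. *)
Definition mild_solution (chi0 : Zd d -> Cr R r) (gamma : Zd d -> R -> Cr R r)
    (T : R) (chi : Zd d -> R -> R) : Prop :=
  forall k,
  [/\ measurable_fun `[0, T] (chi k),
      forall t : R, 0 <= t <= T -> 0 <= chi k t &
      forall t : R, 0 <= t <= T ->
        ((chi k t)%:E =
         (expR (- (lambda c k * t)) * cnorm (chi0 k))%:E +
         \int[@lebesgue_measure R]_(s in `[0%R, t])
           ((lambda c k * expR (- (lambda c k * (t - s))))%:E *
            ((Cflip c * pflip c k * chi k s)%:E +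
             (Cbranch c)%:E *
               (\esum_(lm in [set: Zd d * Zd d])
                  (qbranch c k lm.1 lm.2 * chi lm.1 s * chi lm.2 s)%:E) +
             (pdeath c k * cnorm (gamma k s))%:E)))%E].

End constants.

Arguments constants : clear implicits.

(* Labels are stored with their last entry first: the label written
   (a_1, ..., a_n) is [:: a_n; ...; a_1].  Hence i :: a appends i to the label a,
   rcons a i prepends it, and the restrictions of a label are its suffixes. *)
Definition label := seq 'I_3.

Definition i0 : 'I_3 := @Ordinal 3 0 isT.
Definition i1 : 'I_3 := @Ordinal 3 1 isT.
Definition i2 : 'I_3 := @Ordinal 3 2 isT.

(* [None] is the cemetery state. *)
Record node (R : realType) (d : nat) :=
  Node { pos : option (Zd d); birth : R; death : R }.

Definition tree (R : realType) (d : nat) := label -> node R d.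

Definition subtree (R : realType) (d : nat) (i : 'I_3) (T : tree R d) :
    tree R d := fun a =>
  let n := T (rcons a i) in
  Node (pos n) (birth n - death (T [::])) (death n - death (T [::])).

Section branching_tree.
Context {R : realType} {d r : nat} (c : constants R d r).
Variables (e u : label -> R) (y : label -> Zd d -> Zd d * Zd d) (k : Zd d).

Fixpoint Khat (a : label) : Zd d :=
  match a with
  | [::] => k
  | i :: b => match val i with
              | 0%N => Khat b
              | 1%N => (y b (Khat b)).1
              | _ => (y b (Khat b)).2
              end
  end.

Fixpoint tauD (a : label) : R :=
  (if a is _ :: b then tauD b else 0) + (lambda c (Khat a))^-1 * e a.

Definition tauB (a : label) : R := if a is _ :: b then tauD b else 0.

Definition indicator (a : label) : bool :=
  match a with
  | [::] => true
  | i :: b => if i == i0 then 0 <= u b <= pflip c (Khat b)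
              else 1 - qsum c (Khat b) <= u b <= 1
  end.

Fixpoint alive (a : label) : bool :=
  indicator a && (if a is _ :: b then alive b else true).

Definition branching_tree : tree R d := fun a =>
  Node (if alive a then Some (Khat a) else None) (tauB a) (tauD a).

End branching_tree.

Section evaluation.
Context {R : realType} {d : nat} {V : zmodType}.
Variables (init : Zd d -> V) (force : Zd d -> R -> V) (flip : V -> V).
Variable branch : Zd d -> Zd d -> Zd d -> V -> V -> V.

Definition flip_at_root (T : tree R d) : Prop :=
  [/\ pos (T [:: i0]) <> None, pos (T [:: i1]) = None &
      pos (T [:: i2]) = None].

Definition death_at_root (T : tree R d) : Prop :=
  [/\ pos (T [:: i0]) = None, pos (T [:: i1]) = None &
      pos (T [:: i2]) = None].

Definition branch_at_root (T : tree R d) (l m : Zd d) : Prop :=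
  [/\ pos (T [:: i0]) = None, pos (T [:: i1]) = Some l &
      pos (T [:: i2]) = Some m].

(* [evaluates t T v]: the recursion for the tree T at time t terminates, with
   value v. *)
Inductive evaluates : R -> tree R d -> V -> Prop :=
| evaluates_init t T k :
    pos (T [::]) = Some k -> t <= death (T [::]) ->
    evaluates t T (init k)
| evaluates_death t T k :
    pos (T [::]) = Some k -> death (T [::]) < t -> death_at_root T ->
    evaluates t T (force k (t - death (T [::])))
| evaluates_flip t T k v :
    pos (T [::]) = Some k -> death (T [::]) < t -> flip_at_root T ->
    evaluates (t - death (T [::])) (subtree i0 T) v ->
    evaluates t T (flip v)
| evaluates_branch t T k l m v w :
    pos (T [::]) = Some k -> death (T [::]) < t -> branch_at_root T l m ->
    evaluates (t - death (T [::])) (subtree i1 T) v ->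
    evaluates (t - death (T [::])) (subtree i2 T) w ->
    evaluates t T (branch k l m v w).

(* The value is 0 on the trees for which the recursion does not terminate; the
   lemmas below show that the recursion then holds on those trees too. *)
Definition evaluation (t : R) (T : tree R d) : V := xget 0 (evaluates t T).

Lemma evaluates_inj t T v w : evaluates t T v -> evaluates t T w -> v = w.
Proof.
move=> tv; elim: tv w => {t T v}.
- move=> t T k Tk le_t w tw; case: tw Tk le_t => {t T w}.
  + by move=> t T k' -> _ [->].
  + by move=> t T k' _ lt_t _ _; rewrite leNgt lt_t.
  + by move=> t T k' v _ lt_t _ _ _; rewrite leNgt lt_t.
  + by move=> t T k' l m v w _ lt_t _ _ _ _; rewrite leNgt lt_t.
- move=> t T k Tk lt_t hT w tw; case: tw Tk lt_t hT => {t T w}.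
  + by move=> t T k' _ le_t _; rewrite ltNge le_t.
  + by move=> t T k' -> _ _ [->].
  + by move=> t T k' v _ _ [h _ _] _ _ _ [].
  + by move=> t T k' l m v w _ _ [_ h _] _ _ _ _ []; rewrite h.
- move=> t T k v Tk lt_t hT _ IH w tw; case: tw Tk lt_t hT IH => {t T w}.
  + by move=> t T k' _ le_t _; rewrite ltNge le_t.
  + by move=> t T k' _ _ [h _ _] _ _ [].
  + by move=> t T k' w _ _ _ tw _ _ _ /(_ _ tw) ->.
  + by move=> t T k' l m w w' _ _ [h _ _] _ _ _ _ [].
- move=> t T k l m v v' Tk lt_t hT _ IH _ IH' w tw.
  case: tw Tk lt_t hT IH IH' => {t T w}.
  + by move=> t T k' _ le_t _; rewrite ltNge le_t.
  + by move=> t T k' _ _ [_ h _] _ _ []; rewrite h.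
  + by move=> t T k' w _ _ [h _ _] _ _ _ [].
  + move=> t T k' l' m' w w' Tk' _ [_ h1 h2] tw tw' Tk _ [_].
    rewrite h1 h2 => -[<-] [<-] /(_ _ tw) -> /(_ _ tw') ->.
    by move: Tk; rewrite Tk' => -[->].
Qed.

Lemma evaluationE t T v : evaluates t T v -> evaluation t T = v.
Proof.
move=> tv; rewrite /evaluation; case: xgetP => [w _ tw | /(_ v)//].
exact: evaluates_inj tw tv.
Qed.

Lemma evaluation0 t T : (forall v, ~ evaluates t T v) -> evaluation t T = 0.
Proof. by move=> tN; rewrite /evaluation; case: xgetP => // v _ /tN. Qed.

Lemma evaluation_init t T k : pos (T [::]) = Some k -> t <= death (T [::]) ->
  evaluation t T = init k.
Proof. by move=> Tk le_t; apply/evaluationE/evaluates_init. Qed.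

Lemma evaluation_death t T k : pos (T [::]) = Some k -> death (T [::]) < t ->
  death_at_root T -> evaluation t T = force k (t - death (T [::])).
Proof. by move=> Tk lt_t hT; apply/evaluationE/evaluates_death. Qed.

Lemma evaluation_flip t T k : flip 0 = 0 ->
  pos (T [::]) = Some k -> death (T [::]) < t -> flip_at_root T ->
  evaluation t T = flip (evaluation (t - death (T [::])) (subtree i0 T)).
Proof.
move=> flip0 Tk lt_t hT.
have [[v tv]|tN] := pselect (exists v,
    evaluates (t - death (T [::])) (subtree i0 T) v).
  by rewrite (evaluationE tv); apply/evaluationE/(evaluates_flip Tk).
rewrite [in RHS]evaluation0 => [|v tv]; last by apply: tN; exists v.
rewrite flip0 evaluation0// => v tv; apply: tN.
case: tv Tk lt_t hT => {t T v}.
- by move=> t T k' _ le_t _; rewrite ltNge le_t.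
- by move=> t T k' _ _ [h _ _] _ _ [].
- by move=> t T k' v _ _ _ tv _ _ _; exists v.
- by move=> t T k' l m v w _ _ [h _ _] _ _ _ _ [].
Qed.

Lemma evaluation_branch t T k l m :
  (forall v, branch k l m 0 v = 0) -> (forall v, branch k l m v 0 = 0) ->
  pos (T [::]) = Some k -> death (T [::]) < t -> branch_at_root T l m ->
  evaluation t T =
    branch k l m (evaluation (t - death (T [::])) (subtree i1 T))
                 (evaluation (t - death (T [::])) (subtree i2 T)).
Proof.
move=> b0 b0' Tk lt_t hT.
have H v : evaluates t T v ->
    (exists w, evaluates (t - death (T [::])) (subtree i1 T) w) /\
    (exists w, evaluates (t - death (T [::])) (subtree i2 T) w).
  move=> tv; case: tv lt_t hT {Tk} => {t T v}.
  - by move=> t T k' _ le_t; rewrite ltNge le_t.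
  - by move=> t T k' _ _ [_ h _] _ []; rewrite h.
  - by move=> t T k' v _ _ [h _ _] _ _ [].
  - by move=> t T k' l' m' v w _ _ _ tv tw _ _; split; [exists v|exists w].
have [[v tv]|tN] := pselect (exists v,
    evaluates (t - death (T [::])) (subtree i1 T) v); last first.
  rewrite (@evaluation0 _ (subtree i1 T)) => [|v tv]; last by apply: tN; exists v.
  by rewrite b0 evaluation0// => v /H[].
have [[w tw]|tN] := pselect (exists v,
    evaluates (t - death (T [::])) (subtree i2 T) v); last first.
  rewrite (@evaluation0 _ (subtree i2 T)) => [|w tw]; last by apply: tN; exists w.
  by rewrite b0' evaluation0// => w /H[].
rewrite (evaluationE tv) (evaluationE tw).
exact/evaluationE/(evaluates_branch Tk).
Qed.

End evaluation.

Section R_and_Rtilde.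
Context {R : realType} {d r : nat} (c : constants R d r).
Variables (chi0 : Zd d -> Cr R r) (gamma : Zd d -> R -> Cr R r).

Definition Reval : R -> tree R d -> Cr R r :=
  evaluation chi0 gamma
    (fun v => (Cflip c)%:C%C *: v)
    (fun k l m v w => (Cbranch c)%:C%C *: Bmap c k l m v w).

Definition Rtilde : R -> tree R d -> R :=
  evaluation (fun k => cnorm (chi0 k)) (fun k t => cnorm (gamma k t))
    (fun x => Cflip c * x)
    (fun _ _ _ x x' => Cbranch c * (x * x')).

End R_and_Rtilde.

Section probability.
Context {R : realType} {disp : measure_display} {Omega : measurableType disp}.
Variable P : probability Omega R.

Definition mutually_independent (J : eqType) (G : J -> set_system Omega) :
    Prop :=
  forall (s : seq J) (A : J -> set Omega), uniq s ->
    (forall j, j \in s -> G j (A j)) ->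
    P (\big[setI/setT]_(j <- s) A j) = (\prod_(j <- s) P (A j))%E.

Context {d r : nat} (c : constants R d r).
Variables (E U : label -> {RV P >-> R}).
Variable Y : label -> Zd d -> Omega -> Zd d * Zd d.

(* The sigma-algebras generated by the variables E_a, by the variables U_a and
   by the pairs Y_a(k); the latter take values in a countable discrete set. *)
Definition generated (j : label + label + label * Zd d) : set_system Omega :=
  match j with
  | inl (inl a) => [set E a @^-1` B | B in measurable]
  | inl (inr a) => [set U a @^-1` B | B in measurable]
  | inr (a, k) => [set Y a k @^-1` B | B in [set: set (Zd d * Zd d)]]
  end.

Record branching_variables : Prop := BranchingVariables {
  E_law : forall a (A : set R), measurable A ->
    distribution P (E a) A = exponential_prob 1 A;
  U_law : forall a (A : set R), measurable A ->
    distribution P (U a) A = uniform_prob (@ltr01 R) A;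
  Y_measurable : forall a k (B : set (Zd d * Zd d)),
    measurable (Y a k @^-1` B);
  Y_law : forall a k, 0 < qsum c k -> forall l m,
    P [set w | (Y a k w).1 = l /\ (Y a k w).2 = m] =
    (qbranch c k l m / qsum c k)%:E;
  EUY_independent : mutually_independent generated }.

Definition random_tree (k : Zd d) (w : Omega) : tree R d :=
  branching_tree c (fun a => E a w) (fun a => U a w) (fun a l => Y a l w) k.

(* The integral of F against the law of the tree rooted at k, written on Omega. *)
Definition tree_expectation (k : Zd d) (F : tree R d -> R) : \bar R :=
  ('E_P[fun w => F (random_tree k w)])%E.

End probability.

(* Main.v *)
(* Conditioning on the clock, the type of event and the positions at the root
   shows that one step of the evaluation recursion becomes, in expectation, one
   step of the Picard map of (C): the two subtrees at a branch are independent,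
   hence the product. Let R~^n be the evaluation stopped after n steps, with
   value 0 if the recursion has not terminated. Then E_k[R~^n_t] is the n-th
   Picard iterate from 0, and R~^n increases to R~ pointwise, including on the
   trees where the recursion never ends, since the value is then 0. By monotone
   convergence E_k[R~_t] is a fixed point of the Picard map in [0, +oo]. Every
   mild solution dominates all iterates from 0, hence their limit, which gives
   minimality. The comparison (3) holds tree by tree. *)

Require Import Defs.
From HB Require Import structures.
From mathcomp Require Import all_boot all_order all_algebra.
From mathcomp Require Import all_classical all_reals all_analysis.
From mathcomp Require Import complex.
From mathcomp Require Import measurable_realfun ring lra zify.

Set Implicit Arguments.
Unset Strict Implicit.
Unset Printing Implicit Defensive.

Import Order.TTheory GRing.Theory Num.Theory.
Import numFieldNormedType.Exports.

Local Open Scope classical_set_scope.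
Local Open Scope ring_scope.

(** * Integration *)

(** The obstacle is to condition on the root without conditional expectations and without a
    measurable structure on trees. Everything is therefore a function of a label, a position, a time
    and the sample point: [eval_at a k t] evaluates the subtree at [a] with its root placed at the
    deterministic position [k], and involves only variables indexed by descendants of [a]. Disjoint
    sets of indices generate independent sigma-algebras, and integrals factorize by Tonelli on two
    copies of [Omega], each with its own sub-sigma-algebra. Random child positions are removed by
    summing over their countably many values. Equality in law of the subtrees is never invoked: the
    one-step identity is proved at every label at once, and the Picard iterates do not mention the
    label. Two measurability gaps shape the rest. The evaluation is defined by choice, so its
    measurability comes from the truncated evaluations. The forcing is measurable only on [[0, T]],
    so its norm is cut off there, which changes evaluations only on the null set where some clock is
    negative. Continuity in time is read off the Picard formula, not off the tree. *)

Section integration.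
Local Open Scope ereal_scope.
Context d (T : measurableType d) (R : realType).
Variable mu : {measure set T -> \bar R}.

(* Unlike [ge0_le_integral], without measurability: the evaluations are only
   known to be measurable off a null set. *)
Lemma ge0_le_integral_nonmeas (D : set T) (f g : T -> \bar R) :
  (forall x, D x -> 0 <= f x) -> (forall x, D x -> f x <= g x) ->
  \int[mu]_(x in D) f x <= \int[mu]_(x in D) g x.
Proof.
move=> f0 fg.
have g0 x : D x -> 0 <= g x by move=> Dx; rewrite (le_trans (f0 _ Dx)) ?fg.
rewrite !ge0_integralE//; apply: ereal_sup_le => _ [h hf <-].
exists h => //= x; rewrite (le_trans (hf x))//.
by rewrite !patchE; case: ifPn => // /set_mem; exact: fg.
Qed.

(** Only [g] is measurable. Replacing [g] on [N] by infinity, respectively by 0, keeps its integral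
    and bounds [f] from above, respectively from below; monotonicity of the integral without
    measurability concludes. *)
Lemma ge0_eq_integral_off_null (N : set T) (f g : T -> \bar R) :
  measurable N -> mu N = 0 -> (forall x, 0 <= f x) -> (forall x, 0 <= g x) ->
  measurable_fun setT g -> (forall x, ~ N x -> f x = g x) ->
  \int[mu]_x f x = \int[mu]_x g x.
Proof.
move=> mN N0 f0 g0 mg fg; apply/eqP; rewrite eq_le; apply/andP; split.
  pose h x := g x + +oo%E * (\1_N x)%:E.
  have -> : \int[mu]_x g x = \int[mu]_x h x.
    apply: ge0_ae_eq_integral => //.
    - apply: emeasurable_funD => //; apply: measurable_funeM.
      exact/measurable_EFinP/measurable_indic.
    - by move=> x _; rewrite adde_ge0// mule_ge0// lee_fin.
    - exists N; split => // x /= /not_implyP[_].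
      apply: contra_notP => Nx.
      by rewrite /h indicE memNset// mule0 adde0.
  apply: ge0_le_integral_nonmeas => // x _; rewrite /h indicE.
  have [Nx|Nx] := pselect (N x).
    by rewrite mem_set// mule1 addey ?leey// gt_eqF// (lt_le_trans _ (g0 x)).
  by rewrite memNset// mule0 adde0 fg.
pose h x := g x * (\1_(~` N) x)%:E.
have -> : \int[mu]_x g x = \int[mu]_x h x.
  apply: ge0_ae_eq_integral => //.
  - apply: emeasurable_funM => //.
    by apply/measurable_EFinP/measurable_indic; exact: measurableC.
  - by move=> x _; rewrite mule_ge0// lee_fin.
  - exists N; split => // x /= /not_implyP[_].
    apply: contra_notP => Nx.
    by rewrite /h indicE mem_set// mule1.
apply: ge0_le_integral_nonmeas => [x _|x _]; first by rewrite mule_ge0// lee_fin.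
rewrite /h indicE; have [Nx|Nx] := pselect (N x).
  by rewrite memNset//= ?mule0//; apply.
by rewrite mem_set// mule1 fg.
Qed.

Section density.
Variables (m : {measure set T -> \bar R}) (f : T -> R).
Hypotheses (mf : measurable_fun setT f) (f0 : forall x, (0 <= f x)%R).
Hypothesis mE : forall A, measurable A -> m A = \int[mu]_(x in A) (f x)%:E.

Import HBNNSimple.

Let integral_density_nnsfun (h : {nnsfun T >-> R}) :
  \int[m]_x (h x)%:E = \int[mu]_x ((h x)%:E * (f x)%:E).
Proof.
under eq_integral do rewrite fimfunE -fsumEFin//.
rewrite ge0_integral_fsum//; last 2 first.
  - by move=> r; exact/measurable_EFinP/measurableT_comp.
  - by move=> n x _; rewrite EFinM nnfun_muleindic_ge0.
under [RHS]eq_integral.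
  move=> x _; rewrite fimfunE -fsumEFin// ge0_mule_fsuml; last first.
    by move=> r; rewrite EFinM nnfun_muleindic_ge0.
  over.
rewrite ge0_integral_fsum//; last 2 first.
  - move=> r; apply: emeasurable_funM; last exact/measurable_EFinP.
    by apply/measurable_EFinP; exact: measurable_funM.
  - by move=> r x _; rewrite mule_ge0 ?lee_fin// -lee_fin nnfun_muleindic_ge0.
apply: eq_fsbigr => r _; rewrite integralZl_indic_nnsfun// integral_indic//.
rewrite setIT mE// [in LHS]integral_mkcond.
(* A negative [r] is not a value of [h], so its term vanishes on both sides; a nonnegative one can
   be moved into the integral. *)
have [r0|r0] := ltP r 0%R.
  rewrite preimage_nnfun0//= [X in _ * X]integral0_eq ?mule0 ?integral0_eq//.
    by move=> x _; rewrite indicE in_set0 mulr0 mul0e.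
  by move=> x _; rewrite patchE in_set0.
rewrite -ge0_integralZl//.
- apply: eq_integral => x _; rewrite patchE indicE.
  by case: ifPn => _; rewrite ?mulr1// mulr0 mule0 mul0e.
- apply/(measurable_restrictT _ _).1 => //.
  by apply/measurable_funTS; exact/measurable_EFinP.
- by move=> x _; apply: erestrict_ge0 => y _; rewrite lee_fin.
Qed.

(** The usual extension from simple functions by monotone convergence. It turns integrals against
    the exponential law into Lebesgue integrals. *)
Lemma ge0_integral_density (h : T -> \bar R) :
  measurable_fun setT h -> (forall x, 0 <= h x) ->
  \int[m]_x h x = \int[mu]_x (h x * (f x)%:E).
Proof.
move=> mh h0; pose h_ := nnsfun_approx measurableT mh.
transitivity (limn (fun n => \int[m]_x (h_ n x)%:E)).
  rewrite -monotone_convergence//=.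
  - by apply: eq_integral => x _; apply/esym/cvg_lim => //; exact: cvg_nnsfun_approx.
  - by move=> n; exact/measurable_EFinP.
  - by move=> n ? _; rewrite lee_fin.
  - by move=> ? _ ? ? mn; rewrite lee_fin; exact/lefP/nd_nnsfun_approx.
under eq_fun do rewrite integral_density_nnsfun.
rewrite -monotone_convergence//=.
- apply: eq_integral => x _; apply/cvg_lim => //.
  by apply: cvgeZr => //; exact: cvg_nnsfun_approx.
- by move=> n; apply: emeasurable_funM => //; exact/measurable_EFinP.
- by move=> n ? _; rewrite mule_ge0// lee_fin.
- by move=> ? _ ? ? mn; rewrite lee_wpmul2r ?lee_fin//; exact/lefP/nd_nnsfun_approx.
Qed.

End density.
End integration.


(** * Change of variables and the law of the remaining time *)

Section affine.
Context {R : realType}.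
Local Notation mu := (@lebesgue_measure R).

(** The image of Lebesgue measure under [s |-> a * (t - s)], multiplied by [a], agrees with Lebesgue
    measure on half-open intervals, hence everywhere by uniqueness. The reflection exchanges the
    open and the closed end. *)
Lemma ge0_integral_affine_substitution (a t : R) (f : R -> \bar R) :
  0 < a -> measurable_fun setT f -> (forall x, 0 <= f x)%E ->
  (\int[mu]_x f x = a%:E * \int[mu]_s f (a * (t - s))%R)%E.
Proof.
move=> a0 mf f0.
pose phi : measurableTypeR R -> measurableTypeR R := fun s => a * (t - s).
have mphi : measurable_fun setT phi.
  by apply: measurable_funM => //; exact: measurable_funB.
have a0' : 0 <= a by exact: ltW.
have -> : (\int[mu]_s f (a * (t - s))%R =
    \int[pushforward mu phi]_x f x)%E.
  by rewrite ge0_integral_pushforward.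
rewrite -[a]/((NngNum a0')%:num) -ge0_integral_mscale//.
apply: eq_measure_integral => /= A mA _.
apply: lebesgue_measure_unique => // _ [[x y]] _ <- /=.
rewrite /mscale/= /pushforward.
rewrite (_ : phi @^-1` `]x, y] = `[t - y / a, t - x / a[%classic); last first.
  apply/seteqP; split => s; rewrite /phi/= !in_itv/= => /andP[h1 h2].
    rewrite lerBlDr -lerBlDl ltrBrDr -ltrBrDl ler_pdivlMr// ltr_pdivrMr//.
    by rewrite ![_ * a]mulrC h1 h2.
  move: h1 h2.
  rewrite lerBlDr -lerBlDl ltrBrDr -ltrBrDl ler_pdivlMr// ltr_pdivrMr//.
  by rewrite ![_ * a]mulrC => -> ->.
rewrite !lebesgue_measure_itv/= !lte_fin ltrD2l ltrN2 ltr_pM2r ?invr_gt0//.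
case: ifPn => _; last by rewrite mule0.
by rewrite -!EFinB -EFinM; congr _%:E; field; rewrite gt_eqF.
Qed.

Lemma ge0_integral_exponential_prob (rate : R) (h : R -> \bar R) :
  0 < rate -> measurable_fun setT h -> (forall x, 0 <= h x)%E ->
  (\int[exponential_prob rate]_x h x =
   \int[mu]_(x in `[0%R, +oo[) (h x * (rate * expR (- rate * x))%:E))%E.
Proof.
move=> r0 mh h0; rewrite (@ge0_integral_density _ _ _ mu _ (exponential_pdf rate))//.
- rewrite [RHS]integral_mkcond; apply: eq_integral => x _.
  rewrite /exponential_pdf !patchE; case: ifPn => //; by rewrite mule0.
- exact: measurable_exponential_pdf.
- by move=> x; apply: exponential_pdf_ge0; exact: ltW.
Qed.

(* The law of t - E / a restricted to [0, t], for E exponential of mean one. *)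
Lemma ge0_integral_exponential_clock (a t : R) (g : R -> \bar R) :
  0 < a -> 0 <= t -> measurable_fun setT g -> (forall s, 0 <= g s)%E ->
  (\int[exponential_prob 1]_x (if (a^-1 * x < t)%R then g (t - a^-1 * x)%R else 0) =
   \int[mu]_(s in `[0%R, t]) ((a * expR (- (a * (t - s))))%:E * g s))%E.
Proof.
move=> a0 t0 mg g0.
have mif : measurable_fun setT (fun x : R =>
    if a^-1 * x < t then g (t - a^-1 * x) else 0%E).
  apply: measurable_fun_ifT => //.
  - by apply: measurable_fun_ltr => //; exact: measurable_funM.
  - by apply: measurableT_comp => //; apply: measurable_funB => //.
rewrite ge0_integral_exponential_prob//; last by move=> x; case: ifPn.
rewrite [LHS]integral_mkcond; set h := (X in (\int[mu]_x X x)%E).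
have mh : measurable_fun setT h.
  apply/(measurable_restrictT _ _).1 => //; apply/measurable_funTS.
  apply: emeasurable_funM => //; apply/measurable_EFinP.
  apply: measurable_funM => //; apply: measurableT_comp => //.
have h0 x : (0 <= h x)%E.
  apply: erestrict_ge0 => y _; apply: mule_ge0; first by case: ifPn.
  by rewrite lee_fin; rewrite mul1r expR_ge0.
rewrite (@ge0_integral_affine_substitution a t)//.
rewrite -ge0_integralZl//; last 3 first.
- apply: (measurableT_comp mh).
  by apply: measurable_funM => //; exact: measurable_funB.
- by move=> x _; exact: h0.
- by rewrite lee_fin ltW.
(* The clock rings strictly before [t], so the remaining time is strictly positive; the point 0 is
   null. *)
rewrite -integral_itv_obnd_cbnd; last first.
  apply/measurable_funTS/emeasurable_funM => //; apply/measurable_EFinP.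
  apply: measurable_funM => //; apply: measurableT_comp => //.
  apply: measurableT_comp => //; apply: measurable_funM => //.
  exact: measurable_funB.
rewrite [RHS]integral_mkcond; apply: eq_integral => s _.
rewrite /h !patchE !mem_setE !in_itv/= andbT pmulr_rge0// subr_ge0.
rewrite mulKf ?gt_eqF// ltrBlDr ltrDl subKr mulN1r mul1r.
case: (leP s t) => _; rewrite ?andbF ?mule0// andbT.
by case: ifPn => _; rewrite ?mul0e ?mule0// [(g s * _)%E]muleC muleA -EFinM.
Qed.

End affine.

(** * Sums and selections over a countable type *)

Section countable_sums.
Local Open Scope ereal_scope.
Context {R : realType} {I : countType}.

(** Enumeration by [pickle], with value 0 at the integers that encode nothing; it gives access to
    the theorems on series of nonnegative functions. *)
Lemma esum_countable (f : I -> \bar R) : (forall i, 0 <= f i) ->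
  \esum_(i in [set: I]) f i = \sum_(n <oo) oapp f 0 (pickle_inv n).
Proof.
move=> f0; rewrite nneseries_esumT; last by move=> n; case: (pickle_inv n) => //=.
transitivity (\esum_(i in [set: I]) oapp f 0 (pickle_inv (pickle i))).
  by apply: eq_esum => i _; rewrite pickleK_inv.
rewrite -(@esum_image _ _ _ _ pickle (fun n => oapp f 0 (pickle_inv n))); last first.
  by move=> x y _ _ /(congr1 (@pickle_inv I)); rewrite !pickleK_inv => -[].
rewrite esum_mkcond; apply: eq_esum => n _; case: ifPn => // nI.
case E : (pickle_inv n) => [i|//]; exfalso; move/negP: nI; apply; rewrite inE.
by exists i => //; have := @pickle_invK I n; rewrite /ocancel E.
Qed.

Lemma measurable_fun_esum d (T : measurableType d) (D : set T)
    (f : I -> T -> \bar R) : (forall i, measurable_fun D (f i)) ->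
  (forall i x, D x -> 0 <= f i x) ->
  measurable_fun D (fun x => \esum_(i in [set: I]) f i x).
Proof.
move=> mf f0.
apply: (eq_measurable_fun (fun x => \sum_(n <oo) oapp (f^~ x) 0 (pickle_inv n))).
  by move=> x /set_mem Dx; rewrite esum_countable// => i; exact: f0.
by apply: ge0_emeasurable_sum => [n x Dx _|n _]; case: (pickle_inv n) => //= i;
  exact: f0.
Qed.

Lemma ge0_integral_esum d (T : measurableType d)
    (mu : {measure set T -> \bar R}) (D : set T) (f : I -> T -> \bar R) :
  measurable D -> (forall i, measurable_fun D (f i)) ->
  (forall i x, D x -> 0 <= f i x) ->
  \int[mu]_(x in D) (\esum_(i in [set: I]) f i x) =
  \esum_(i in [set: I]) \int[mu]_(x in D) f i x.
Proof.
move=> mD mf f0.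
rewrite esum_countable; last by move=> i; apply: integral_ge0 => x; exact: f0.
rewrite (eq_integral (fun x => \sum_(n <oo) oapp (f^~ x) 0 (pickle_inv n))).
  rewrite integral_nneseries//; last 2 first.
  - by move=> n; case: (pickle_inv n) => //= i.
  - by move=> n x Dx; case: (pickle_inv n) => //= i; exact: f0.
  apply: eq_eseriesr => n _; case: (pickle_inv n) => //=.
  by rewrite integral0.
by move=> x /set_mem Dx; rewrite esum_countable// => i; exact: f0.
Qed.

Lemma esumZl (a : R) (f : I -> \bar R) : (0 <= a)%R -> (forall i, 0 <= f i) ->
  \esum_(i in [set: I]) (a%:E * f i) = a%:E * \esum_(i in [set: I]) f i.
Proof.
move=> a0 f0; rewrite !esum_countable//; last by move=> i; rewrite mule_ge0.
rewrite -nneseriesZl//; last by move=> n _; case: (pickle_inv n) => //=.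
by apply: eq_eseriesr => n _; case: (pickle_inv n) => //=; rewrite mule0.
Qed.

End countable_sums.

(** The preimage of a set is a countable union over the values of [z]. The case of interest is a
    random position at which a family of functions is evaluated. *)
Lemma measurable_fun_select d (T : measurableType d) d' (T' : measurableType d')
    (I : countType) (z : T -> I) (f : I -> T -> T') :
  (forall i, measurable (z @^-1` [set i])) ->
  (forall i, measurable_fun setT (f i)) ->
  measurable_fun setT (fun x => f (z x) x).
Proof.
move=> mz mf _ B mB; rewrite setTI.
rewrite (_ : _ @^-1` B = \bigcup_i (z @^-1` [set i] `&` f i @^-1` B)).
  apply: countable_bigcupT_measurable => //.
  by move=> i; apply: measurableI => //; rewrite -[_ @^-1` _]setTI; exact: mf.
apply/seteqP; split => x /=; first by exists (z x).
by move=> [i _ [/= <-]].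
Qed.

(** * Independence *)

Section independence.
Context d (Omega : measurableType d) (R : realType) (P : probability Omega R).
Variables (J : choiceType) (G : J -> set_system Omega).
Hypothesis G_measurable : forall j A, G j A -> measurable A.
Hypothesis G_setI : forall j, setI_closed (G j).
Hypothesis G_setT : forall j, G j setT.
Hypothesis G_indep : mutually_independent P G.

Local Notation sub_salgebra D := (g_sigma_algebraType (\bigcup_(j in D) G j)).

(** The pi-system generating the sigma-algebra of the indices in [D]. The family [A] is total, so
    that two cylinders can be intersected index by index over the union of their supports. *)
Let cylinder (D : set J) : set_system Omega :=
  [set B | exists (s : seq J) (A : J -> set Omega),
    [/\ uniq s, forall j, j \in s -> D j, forall j, G j (A j) &
        B = \big[setI/setT]_(j <- s) A j]].

Let in_bigsetI (s : seq J) (A : J -> set Omega) w :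
  (\big[setI/setT]_(j <- s) A j) w <-> forall j, j \in s -> A j w.
Proof.
rewrite -bigcap_seq; split => [h j js|h j /= js]; [exact: h|exact: h].
Qed.

Let cylinderI D : setI_closed (cylinder D).
Proof.
move=> _ _ [s [A [us sD GA ->]]] [s' [A' [us' sD' GA' ->]]].
exists (undup (s ++ s')),
  (fun j => (if j \in s then A j else setT) `&` (if j \in s' then A' j else setT)).
split; first exact: undup_uniq.
- by move=> j; rewrite mem_undup mem_cat => /orP[/sD|/sD'].
- by move=> j; apply: G_setI; case: ifPn.
- apply/seteqP; split => [w [/in_bigsetI h /in_bigsetI h']|w].
    apply/in_bigsetI => j _; split; case: ifPn => // ?; [exact: h|exact: h'].
  move=> /in_bigsetI h; split; apply/in_bigsetI => j js.
    by have := h j; rewrite mem_undup mem_cat js/= => /(_ isT)[].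
  by have := h j; rewrite mem_undup mem_cat js orbT/= => /(_ isT)[_].
Qed.

Let salgebra_cylinder D : <<s \bigcup_(j in D) G j >> = <<s cylinder D >>.
Proof.
apply/seteqP; split; apply: smallest_sub; try exact: smallest_sigma_algebra.
  move=> A [j Dj GA]; apply: sub_sigma_algebra.
  exists [:: j], (fun i => if i == j then A else setT); split => //.
  - by move=> i; rewrite inE => /eqP ->.
  - by move=> i; case: eqVneq => // ->.
  - by rewrite big_seq1 eqxx.
move=> _ [s [A [_ sD GA ->]]].
rewrite big_seq; elim/big_ind : _.
- exact: (@measurableT _ (g_sigma_algebraType (\bigcup_(j in D) G j))).
- move=> X Y.
  exact: (@measurableI _ (g_sigma_algebraType (\bigcup_(j in D) G j))).
- by move=> j /sD Dj; apply: sub_sigma_algebra; exists j.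
Qed.

Lemma sub_salgebra_measurable D (A : set Omega) :
  <<s \bigcup_(j in D) G j >> A -> measurable A.
Proof.
apply: smallest_sub; first exact: sigma_algebra_measurable.
by move=> B [j _]; exact: G_measurable.
Qed.

Lemma sub_salgebraS D D' : D `<=` D' ->
  <<s \bigcup_(j in D) G j >> `<=` <<s \bigcup_(j in D') G j >>.
Proof. by move=> DD'; apply: sub_sigma_algebra2; exact: bigcup_subset. Qed.

Let indep_cylinders D D' A B : D `&` D' = set0 ->
  cylinder D A -> cylinder D' B -> P (A `&` B) = (P A * P B)%E.
Proof.
move=> DD' [s [X [us sD GX ->]]] [s' [X' [us' sD' GX' ->]]].
have dis j : j \in s -> j \in s' -> False.
  by move=> /sD h /sD' h'; have : (D `&` D') j by []; rewrite DD'.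
(* As [D] and [D'] are disjoint, a single family carries both cylinders, and the concatenated list
   of indices has no repetition. *)
pose Z j := if j \in s then X j else X' j.
have E1 : \big[setI/setT]_(j <- s) X j = \big[setI/setT]_(j <- s) Z j.
  by apply: eq_big_seq => j js; rewrite /Z js.
have E2 : \big[setI/setT]_(j <- s') X' j = \big[setI/setT]_(j <- s') Z j.
  apply: eq_big_seq => j js; rewrite /Z; case: ifPn => // js'.
  by case: (dis j).
have GZ j : G j (Z j) by rewrite /Z; case: ifPn.
rewrite E1 E2 -big_cat/= G_indep//; last first.
  rewrite cat_uniq us us' andbT/=; apply/hasPn => j js'.
  by apply/negP => js; exact: (dis j).
by rewrite big_cat/= !G_indep.
Qed.

(** The events independent of a fixed [B] form a Dynkin system, so independence passes from a
    pi-system to the sigma-algebra it generates. It is used once for each of the two arguments. *)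
Let indep_extend (C : set_system Omega) (B : set Omega) : measurable B ->
  setI_closed C -> C `<=` measurable ->
  (forall A, C A -> P (A `&` B) = (P A * P B)%E) ->
  forall A, <<s C >> A -> P (A `&` B) = (P A * P B)%E.
Proof.
move=> mB CI Cm CB A CA.
suff : <<s C >> `<=` [set A | measurable A /\ P (A `&` B) = (P A * P B)%E].
  by move=> /(_ _ CA)[].
apply: lambda_system_subset => //; last by move=> X CX; split; [exact: Cm|exact: CB].
apply/dynkin_lambda_system; split.
- by split => //; rewrite setTI probability_setT mul1e.
- move=> X [mX XB]; split; first exact: measurableC.
  transitivity (P B - P (X `&` B))%E.
    rewrite setIC -setDE measureD 1?[B `&` X]setIC//.
    by rewrite (le_lt_trans (probability_le1 _ _)) ?ltry.
  rewrite XB.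
  by rewrite probability_setC// muleBl// ?mul1e// fin_num_measure.
- move=> F tF FB; split; first by apply: bigcupT_measurable => n; case: (FB n).
  rewrite setI_bigcupl !measure_bigcup//=.
  + rewrite muleC -[P B]fineK ?fin_num_measure// -nneseriesZl//.
    by apply: eq_eseriesr => n _; rewrite fineK ?fin_num_measure// muleC; case: (FB n).
  + by move=> n _; case: (FB n).
  + by move=> n _; apply: measurableI => //; case: (FB n).
  + by apply: trivIset_setIr.
Qed.

Lemma indep_sub_salgebra D D' A B : D `&` D' = set0 ->
  <<s \bigcup_(j in D) G j >> A -> <<s \bigcup_(j in D') G j >> B ->
  P (A `&` B) = (P A * P B)%E.
Proof.
move=> DD' sA sB; have mA := sub_salgebra_measurable sA.
have mB := sub_salgebra_measurable sB.
have Cm K : cylinder K `<=` measurable.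
  move=> X KX; apply: (@sub_salgebra_measurable K).
  by rewrite salgebra_cylinder; exact: sub_sigma_algebra.
move: sA; rewrite salgebra_cylinder; apply: indep_extend => // {mA} A CA.
rewrite setIC muleC; move: sB; rewrite salgebra_cylinder.
apply: indep_extend => //; first exact: Cm CA.
by move=> X CX; rewrite setIC muleC; exact: indep_cylinders CA CX.
Qed.

Lemma measurable_id_sub_salgebra D :
  measurable_fun setT (id : Omega -> sub_salgebra D).
Proof. by move=> _ A mA; rewrite setTI; exact: sub_salgebra_measurable mA. Qed.

(** The random variables are identity maps from [Omega] to itself with a smaller sigma-algebra. By
    independence the law of the diagonal map is the product of the two marginals, since both agree
    on rectangles; Tonelli then gives the iterated integral. *)
Lemma integral_independent D D' (H : sub_salgebra D * sub_salgebra D' -> \bar R) :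
  D `&` D' = set0 -> measurable_fun setT H -> (forall x, 0 <= H x)%E ->
  (\int[P]_w H (w, w) = \int[P]_w \int[P]_w' H (w, w'))%E.
Proof.
move=> DD' mH H0.
pose X K : {mfun Omega >-> sub_salgebra K} := HB.pack (id : Omega -> sub_salgebra K)
  (isMeasurableFun.Build _ _ _ _ _ (@measurable_id_sub_salgebra K)).
pose diag (w : Omega) : sub_salgebra D * sub_salgebra D' := (w, w).
have mdiag : measurable_fun setT diag.
  by apply: measurable_fun_pair; exact: measurable_id_sub_salgebra.
pose Z : {mfun Omega >-> (sub_salgebra D * sub_salgebra D')%type} := HB.pack diag
  (isMeasurableFun.Build _ _ _ _ _ mdiag).
have E A B : measurable A -> measurable B ->
    distribution P Z (A `*` B) = (distribution P (X D) A * distribution P (X D') B)%E.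
  move=> mA mB; rewrite /distribution/= /pushforward.
  exact: indep_sub_salgebra mA mB.
transitivity (\int[distribution P Z]_x H x)%E.
  by rewrite ge0_integral_distribution.
transitivity (\int[distribution P (X D) \x distribution P (X D')]_x H x)%E.
  apply: eq_measure_integral => A mA _; apply/esym.
  exact: (product_measure_unique E).
rewrite fubini_tonelli1// ge0_integral_distribution//; last 2 first.
- exact: measurable_fun_fubini_tonelli_F.
- by move=> y; apply: integral_ge0.
apply: eq_integral => w _ /=; rewrite /fubini_F ge0_integral_distribution//.
exact: measurableT_comp.
Qed.

End independence.

(** * Evaluations of a fixed tree *)

Section cnorm.
Context {R : realType} {r : nat}.
Implicit Type v : Cr R r.

Lemma cnorm_ge0 v : 0 <= cnorm v. Proof. exact: sqrtr_ge0. Qed.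

Lemma cnorm0 : cnorm (0 : Cr R r) = 0.
Proof.
rewrite /cnorm big1 ?sqrtr0// => i _.
by rewrite !mxE/= expr0n addr0.
Qed.

Lemma cnormZ (a : R) v : 0 <= a -> cnorm (a%:C%C *: v) = a * cnorm v.
Proof.
move=> a0; rewrite /cnorm.
rewrite (eq_bigr (fun i => a ^+ 2 *
    (complex.Re (v i 0) ^+ 2 + complex.Im (v i 0) ^+ 2))); last first.
  by move=> i _; rewrite !mxE; case: (v i 0) => x y /=; ring.
by rewrite -mulr_sumr sqrtrM ?sqr_ge0// sqrtr_sqr ger0_norm.
Qed.

End cnorm.

(** * Comparison of the two evaluations, tree by tree *)

Section comparison.
Context {R : realType} {d r : nat} (c : constants R d r).
Hypothesis hc : standing_assumptions c.
Variables (chi0 : Zd d -> Cr R r) (gamma : Zd d -> R -> Cr R r).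

Local Notation evalv := (evaluates chi0 gamma (fun v => (Cflip c)%:C%C *: v)
    (fun k l m v w => (Cbranch c)%:C%C *: Bmap c k l m v w)).
Local Notation evalr := (evaluates (fun k => cnorm (chi0 k))
    (fun k t => cnorm (gamma k t)) (fun x => Cflip c * x)
    (fun _ _ _ x x' => Cbranch c * (x * x'))).

Let evalv_evalr t T v : evalv t T v -> exists2 x, evalr t T x & cnorm v <= x.
Proof.
elim=> {t T v}.
- by move=> t T k Tk h; exists (cnorm (chi0 k)) => //; exact: evaluates_init.
- move=> t T k Tk h hT; exists (cnorm (gamma k (t - death (T [::])))) => //.
  exact: (evaluates_death (fun k => cnorm (chi0 k)) (fun k t => cnorm (gamma k t))).
- move=> t T k v Tk h hT _ [x tx vx]; exists (Cflip c * x).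
    exact: (evaluates_flip Tk h hT tx).
  by rewrite cnormZ ?(Cflip_ge0 hc)// ler_wpM2l// (Cflip_ge0 hc).
- move=> t T k l m v w Tk h hT _ [x tx vx] _ [y ty wy].
  exists (Cbranch c * (x * y)); first exact: (evaluates_branch Tk h hT tx ty).
  rewrite cnormZ ?(Cbranch_ge0 hc)// ler_wpM2l// ?(Cbranch_ge0 hc)//.
  by rewrite (le_trans (Bmap_bound hc _ _ _ _ _))// ler_pM// cnorm_ge0.
Qed.

(** Termination depends on the tree and the time only, so both evaluations take the default value 0
    on the same trees. *)
Let evalr_evalv t T x : evalr t T x -> exists v, evalv t T v.
Proof.
elim=> {t T x}.
- by move=> t T k Tk h; exists (chi0 k); exact: evaluates_init.
- move=> t T k Tk h hT; exists (gamma k (t - death (T [::]))).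
  exact: evaluates_death.
- by move=> t T k x Tk h hT _ [v tv]; exists ((Cflip c)%:C%C *: v);
    exact: (evaluates_flip Tk h hT tv).
- move=> t T k l m x y Tk h hT _ [v tv] _ [w tw].
  exists ((Cbranch c)%:C%C *: Bmap c k l m v w).
  exact: (evaluates_branch Tk h hT tv tw).
Qed.

Lemma cnorm_Reval_le t T : cnorm (Reval c chi0 gamma t T) <= Rtilde c chi0 gamma t T.
Proof.
have [[v tv]|tN] := pselect (exists v, evalv t T v).
  have [x tx vx] := evalv_evalr tv.
  by rewrite /Reval /Rtilde (evaluationE tv) (evaluationE tx).
rewrite /Reval /Rtilde !evaluation0 ?cnorm0// => [x tx|v tv]; apply: tN.
  exact: evalr_evalv tx.
by exists v.
Qed.

Lemma cnorm_RevalE t T :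
  (forall k l m u v, cnorm (Bmap c k l m u v) = cnorm u * cnorm v) ->
  cnorm (Reval c chi0 gamma t T) = Rtilde c chi0 gamma t T.
Proof.
move=> BE.
have H t' T' v : evalv t' T' v -> evalr t' T' (cnorm v).
  elim=> {t' T' v}.
  - by move=> t' T' k Tk h; exact: (evaluates_init (fun k => cnorm (chi0 k))).
  - move=> t' T' k Tk h hT.
    exact: (evaluates_death (fun k => cnorm (chi0 k)) (fun k t => cnorm (gamma k t))).
  - move=> t' T' k v Tk h hT _ tv; rewrite cnormZ ?(Cflip_ge0 hc)//.
    exact: (evaluates_flip Tk h hT tv).
  - move=> t' T' k l m v w Tk h hT _ tv _ tw.
    rewrite cnormZ ?(Cbranch_ge0 hc)// BE.
    exact: (evaluates_branch Tk h hT tv tw).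
have [[v tv]|tN] := pselect (exists v, evalv t T v).
  by rewrite /Reval /Rtilde (evaluationE tv) (evaluationE (H _ _ _ tv)).
rewrite /Reval /Rtilde !evaluation0 ?cnorm0// => [x tx|v tv]; apply: tN.
  exact: evalr_evalv tx.
by exists v.
Qed.

End comparison.

(** * Subtrees are branching trees of shifted variables *)

Section subtrees.
Context {R : realType} {d r : nat} (c : constants R d r).
Variables (e u : label -> R) (y : label -> Zd d -> Zd d * Zd d) (k : Zd d).
Variable i : 'I_3.

Let shift S (f : label -> S) (b : label) := f (rcons b i).
Let ki := Khat y k [:: i].

Let Khat_rcons b : Khat y k (rcons b i) = Khat (shift y) ki b.
Proof. by elim: b => //= j b ->. Qed.

Let tauD_rcons b : tauD c e y k (rcons b i) =
  tauD c e y k [::] + tauD c (shift e) (shift y) ki b.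
Proof.
elim: b => [|j b IH]; first by rewrite /= !add0r.
by rewrite /= IH Khat_rcons -addrA.
Qed.

Let alive_rcons b : alive c u y k [:: i] ->
  alive c u y k (rcons b i) = alive c (shift u) (shift y) ki b.
Proof.
move=> ai; elim: b => [|j b IH]; first exact: ai.
by rewrite /= IH Khat_rcons.
Qed.

(** The recursions for positions, times and survival run towards the root, so prepending [i] to
    every label changes only where they stop. The hypothesis accounts for the indicator of the
    child, which becomes a root and hence is alive by definition; the times lose the death time of
    the old root. *)
Lemma subtree_branching_tree : alive c u y k [:: i] ->
  subtree i (branching_tree c e u y k) =
  branching_tree c (shift e) (shift u) (shift y) ki.
Proof.
move=> ai; apply/funext => b; rewrite /subtree /branching_tree/=; congr Node.
- by rewrite alive_rcons// Khat_rcons.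
- case: b => [|j b]; first by rewrite /= subrr.
  by rewrite /tauB rcons_cons tauD_rcons addrAC subrr add0r.
- by rewrite tauD_rcons addrAC subrr add0r.
Qed.

End subtrees.

(** * Evaluations as limits of truncated recursions *)

Section subtree_at.
Context {R : realType} {d r : nat} (c : constants R d r).
Variables (e u : label -> R) (y : label -> Zd d -> Zd d * Zd d).
Hypothesis hc : standing_assumptions c.
Variables (init : Zd d -> R) (force : Zd d -> R -> R).
Hypotheses (init_ge0 : forall k, 0 <= init k)
  (force_ge0 : forall k t, 0 <= force k t).

(* The tree at the label a, as if its root were alive and at position k. *)
Definition tree_at (a : label) (k : Zd d) : tree R d :=
  branching_tree c (fun b => e (b ++ a)) (fun b => u (b ++ a))
    (fun b => y (b ++ a)) k.

Definition may_flip (a : label) (k : Zd d) : bool := 0 <= u a <= pflip c k.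
Definition may_branch (a : label) (k : Zd d) : bool :=
  1 - qsum c k <= u a <= 1.

Definition lifetime (a : label) (k : Zd d) : R := (lambda c k)^-1 * e a.

(* One step of the recursion, the values on the three subtrees being given by W.
   The case where both a flip and a branch are allowed is null (it is the common
   endpoint of two intervals) and no evaluation exists there. *)
Definition step (W : label -> Zd d -> R -> R) (a : label) (k : Zd d) (t : R) : R :=
  let s := t - lifetime a k in
  if t <= lifetime a k then init k
  else if may_flip a k then
    if may_branch a k then 0 else Cflip c * W (i0 :: a) k s
  else if may_branch a k then
    Cbranch c * (W (i1 :: a) (y a k).1 s * W (i2 :: a) (y a k).2 s)
  else force k s.

Definition eval_at (a : label) (k : Zd d) (t : R) : R :=
  evaluation init force (fun x => Cflip c * x)
    (fun _ _ _ x x' => Cbranch c * (x * x')) t (tree_at a k).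

(* The value is 0 unless the recursion terminates within n steps, so that these
   are nondecreasing in n. *)
Definition eval_upto (n : nat) : label -> Zd d -> R -> R :=
  iter n step (fun _ _ _ => 0).

Local Notation evals := (evaluates init force (fun x => Cflip c * x)
    (fun _ _ _ x x' => Cbranch c * (x * x'))).

Let pos_root a k : pos (tree_at a k [::]) = Some k. Proof. by []. Qed.

Let death_root a k : death (tree_at a k [::]) = lifetime a k.
Proof. by rewrite /= add0r. Qed.

Let pos_child0 a k :
  pos (tree_at a k [:: i0]) = if may_flip a k then Some k else None.
Proof. by rewrite /= andbT. Qed.

Let pos_child1 a k :
  pos (tree_at a k [:: i1]) = if may_branch a k then Some (y a k).1 else None.
Proof. by rewrite /= andbT. Qed.

Let pos_child2 a k :
  pos (tree_at a k [:: i2]) = if may_branch a k then Some (y a k).2 else None.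
Proof. by rewrite /= andbT. Qed.

Let subtree_tree_at i a k : pos (tree_at a k [:: i]) <> None ->
  subtree i (tree_at a k) = tree_at (i :: a) (Khat (fun b => y (b ++ a)) k [:: i]).
Proof.
have E S (f : label -> S) : (fun b => f (b ++ i :: a)) = (fun b => f (rcons b i ++ a)).
  by apply/funext => b; rewrite cat_rcons.
move=> ai; rewrite /tree_at subtree_branching_tree.
  by rewrite (E _ e) (E _ u) (E _ y).
by move: ai; rewrite /tree_at /branching_tree/=; case: ifP.
Qed.

Let subtree0 a k : may_flip a k -> subtree i0 (tree_at a k) = tree_at (i0 :: a) k.
Proof. by move=> f; rewrite subtree_tree_at// pos_child0 f. Qed.

Let subtree1 a k : may_branch a k ->
  subtree i1 (tree_at a k) = tree_at (i1 :: a) (y a k).1.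
Proof. by move=> f; rewrite subtree_tree_at// pos_child1 f. Qed.

Let subtree2 a k : may_branch a k ->
  subtree i2 (tree_at a k) = tree_at (i2 :: a) (y a k).2.
Proof. by move=> f; rewrite subtree_tree_at// pos_child2 f. Qed.

Lemma eval_at_step a k t : eval_at a k t = step eval_at a k t.
Proof.
rewrite /step; case: leP => [le_t|lt_t].
  by rewrite /eval_at (evaluation_init _ _ _ _ (pos_root a k))// death_root.
rewrite -(death_root a k) in lt_t *.
case: ifPn => f; case: ifPn => b.
(* All three children are alive: this is neither a death, nor a flip, nor a branch, so no evaluation
   exists and the default 0 is the value given by [step]. *)
- rewrite /eval_at evaluation0// => v tv.
  have P0 := pos_child0 a k; have P1 := pos_child1 a k.
  rewrite f in P0; rewrite b in P1.
  case: tv lt_t P0 P1 => {t v} t T l.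
  + by rewrite leNgt => _ /negbTE ->.
  + by move=> _ _ [->].
  + by move=> v _ _ [_ -> _].
  + by move=> m m' v w _ _ [->].
- rewrite /eval_at (evaluation_flip _ _ _ (mulr0 _) (pos_root a k))//.
    by rewrite subtree0.
  by split; rewrite ?pos_child0 ?pos_child1 ?pos_child2 ?f ?(negbTE b).
- rewrite /eval_at (evaluation_branch (l := (y a k).1) (m := (y a k).2)
    _ _ _ _ _ (pos_root a k))//.
  + by rewrite subtree1// subtree2.
  + by move=> v; rewrite mul0r mulr0.
  + by move=> v; rewrite !mulr0.
  + by split; rewrite ?pos_child0 ?pos_child1 ?pos_child2 ?b ?(negbTE f).
- rewrite /eval_at (evaluation_death _ _ _ _ (pos_root a k))//.
  by split; rewrite ?pos_child0 ?pos_child1 ?pos_child2 ?(negbTE b) ?(negbTE f).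
Qed.

Lemma step_ge0 W a k t : (forall a k t, 0 <= W a k t) -> 0 <= step W a k t.
Proof.
move=> W0; rewrite /step; case: ifP => // _; case: ifP => _; case: ifP => _ //.
- by rewrite mulr_ge0// (Cflip_ge0 hc).
- by rewrite !mulr_ge0// (Cbranch_ge0 hc).
Qed.

Lemma eval_upto_ge0 n a k t : 0 <= eval_upto n a k t.
Proof. by elim: n a k t => //= n IH a k t; exact: step_ge0. Qed.

Lemma eval_upto_nondecreasing a k t :
  nondecreasing_seq (fun n => eval_upto n a k t).
Proof.
apply/nondecreasing_seqP => n; elim: n a k t => [|n IH] a k t.
  exact: eval_upto_ge0.
rewrite /= /step; case: ifP => // _; case: ifP => _; case: ifP => _ //.
- by rewrite ler_wpM2l// (Cflip_ge0 hc).
- rewrite ler_wpM2l// ?(Cbranch_ge0 hc)//.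
  by rewrite ler_pM//; exact: eval_upto_ge0.
Qed.

(** The initial value 0 is absorbed both by the factor at a flip and by the product at a branch: a
    truncated value is either 0 or the true one. *)
Let eval_upto_evaluates n a k t :
  eval_upto n a k t = 0 \/ evals t (tree_at a k) (eval_upto n a k t).
Proof.
elim: n a k t => [|n IH] a k t /=; first by left.
rewrite /step; case: leP => [le_t|lt_t].
  by right; apply: evaluates_init; rewrite ?death_root.
case: ifPn => f; case: ifPn => b; first by left.
- have [->|IH0] := IH (i0 :: a) k (t - lifetime a k); first by left; rewrite mulr0.
  right; apply: (@evaluates_flip _ _ _ _ _ (fun x => Cflip c * x)
    _ _ _ _ _ (pos_root a k)).
  + by rewrite death_root.
  + by split; rewrite ?pos_child0 ?pos_child1 ?pos_child2 ?f ?(negbTE b).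
  + by rewrite subtree0// death_root.
- have [->|IH1] := IH (i1 :: a) (y a k).1 (t - lifetime a k).
    by left; rewrite mul0r mulr0.
  have [->|IH2] := IH (i2 :: a) (y a k).2 (t - lifetime a k).
    by left; rewrite !mulr0.
  right; apply: (@evaluates_branch _ _ _ _ _ _
    (fun _ _ _ x x' => Cbranch c * (x * x')) _ _ _ (y a k).1 (y a k).2
    _ _ (pos_root a k)).
  + by rewrite death_root.
  + by split; rewrite ?pos_child0 ?pos_child1 ?pos_child2 ?b ?(negbTE f).
  + by rewrite subtree1// death_root.
  + by rewrite subtree2// death_root.
- right; rewrite -(death_root a k); apply: evaluates_death => //.
  + by rewrite death_root.
  + by split; rewrite ?pos_child0 ?pos_child1 ?pos_child2 ?(negbTE b) ?(negbTE f).
Qed.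

Let evaluates_eventually t T v : evals t T v -> forall a k, T = tree_at a k ->
  exists N, forall n, (N <= n)%N -> eval_upto n a k t = eval_at a k t.
Proof.
have E n a k s : (0 < n)%N -> eval_upto n a k s = step (eval_upto n.-1) a k s.
  by case: n.
elim=> {t T v}.
- move=> t T _ _ + a k TE; rewrite TE death_root => le_t.
  by exists 1%N => n n0; rewrite E// eval_at_step /step le_t.
- move=> t T _ _ + + a k TE; rewrite TE death_root => lt_t.
  rewrite /death_at_root pos_child0 pos_child1 => -[].
  case: ifP => // f; case: ifP => // b _ _ _.
  by exists 1%N => n n0; rewrite E// eval_at_step /step f b.
- move=> t T _ v _ + + _ + a k TE; rewrite TE death_root => lt_t.
  rewrite /flip_at_root pos_child0 pos_child1 => -[].
  case: ifP => // f; case: ifP => // b _ _ _.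
  move=> /(_ (i0 :: a) k); rewrite subtree0// => /(_ erefl)[N HN].
  exists N.+1 => -[//|n] nN; rewrite E// eval_at_step /step f b.
  by rewrite HN.
- move=> t T _ l m v w _ + + _ + _ + a k TE; rewrite TE death_root => lt_t.
  rewrite /branch_at_root pos_child0 pos_child1 => -[].
  case: ifP => // f; case: ifP => // b _ _ _.
  move=> /(_ (i1 :: a) (y a k).1); rewrite subtree1// => /(_ erefl)[N HN].
  move=> /(_ (i2 :: a) (y a k).2); rewrite subtree2// => /(_ erefl)[M HM].
  exists (maxn N M).+1 => -[//|n]; rewrite ltnS geq_max => /andP[nN nM].
  by rewrite E// eval_at_step /step f b HN// HM.
Qed.

(** If the recursion terminates, induction on its derivation bounds its depth. If not, the truncated
    values can only be 0, which is also the default value. *)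
Lemma eval_upto_eventually a k t :
  exists N, forall n, (N <= n)%N -> eval_upto n a k t = eval_at a k t.
Proof.
have [[v tv]|tN] := pselect (exists v, evals t (tree_at a k) v).
  exact: (evaluates_eventually tv).
exists 0%N => n _; rewrite /eval_at evaluation0; last first.
  by move=> v tv; apply: tN; exists v.
by case: (eval_upto_evaluates n a k t) => // tv; case: tN; eexists; exact: tv.
Qed.

Lemma eval_at_ge0 a k t : 0 <= eval_at a k t.
Proof.
have [N HN] := eval_upto_eventually a k t.
by rewrite -(HN N)//; exact: eval_upto_ge0.
Qed.

Lemma cvg_eval_upto a k t : eval_upto n a k t @[n --> \oo] --> eval_at a k t.
Proof.
have [N HN] := eval_upto_eventually a k t.
by apply: cvg_near_cst; exists N.
Qed.

End subtree_at.

(** With nonnegative clocks the time argument can only decrease along the recursion, and the forcing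
    is read only after the clock has rung, hence at times in [[0, T]]. The truncated evaluations
    carry the induction. *)
Lemma eval_at_eq_force {R : realType} {d r : nat} (c : constants R d r)
    (e u : label -> R) (y : label -> Zd d -> Zd d * Zd d)
    (init : Zd d -> R) (force force' : Zd d -> R -> R) (T : R) (a : label)
    (k : Zd d) (t : R) :
  standing_assumptions c -> (forall b, 0 <= e b) -> t <= T ->
  (forall l s, 0 <= s <= T -> force l s = force' l s) ->
  eval_at c e u y init force a k t = eval_at c e u y init force' a k t.
Proof.
move=> hc e0 tT ff'.
have uptoE n b l s : s <= T ->
    eval_upto c e u y init force n b l s = eval_upto c e u y init force' n b l s.
  elim: n b l s => // n IH b l s sT; rewrite /= /step; case: leP => // lt_s.
  have l0 : 0 <= lifetime c e b l.
    by rewrite mulr_ge0// invr_ge0 ltW// (lambda_gt0 hc).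
  have s'T : s - lifetime c e b l <= T by rewrite (le_trans _ sT)// gerBl.
  by rewrite !IH// ff'// s'T subr_ge0 ltW.
have [N HN] := eval_upto_eventually c e u y init force a k t.
have [M HM] := eval_upto_eventually c e u y init force' a k t.
by rewrite -(HN (maxn N M)) ?leq_maxl// -(HM (maxn N M)) ?leq_maxr// uptoE.
Qed.

(** * Conditioning on the root *)

Lemma exponential_prob_itvNyo {R : realType} (x : R) : 0 <= x ->
  exponential_prob 1 `]-oo, x[ = (1 - (expR (- x))%:E)%E.
Proof.
rewrite le_eqVlt => /predU1P[<-|x0].
  rewrite oppr0 expR0 subee// /exponential_prob integral0_eq// => y.
  by rewrite /= in_itv/= => y0; rewrite lt0_exponential_pdf.
rewrite -(mul1r x) -mulNr -exponential_prob_itv0c// /exponential_prob mul1r.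
rewrite -integral_itv_bndo_bndc; last first.
  by apply/measurable_funTS/measurable_EFinP; exact: measurable_exponential_pdf.
rewrite [LHS]integral_mkcond [RHS]integral_mkcond; apply: eq_integral => y _.
rewrite !patchE !mem_setE !in_itv/=; have [y0|y0] := leP 0 y => //=.
by rewrite lt0_exponential_pdf//; case: ifP.
Qed.

Lemma esum_single {R : realType} {I : choiceType} (i : I) (f : I -> \bar R) :
  (0 <= f i)%E -> (forall j, j != i -> f j = 0%E) ->
  (\esum_(j in [set: I]) f j = f i)%E.
Proof.
move=> f0 fi; rewrite -(esum_set1 f0) [RHS]esum_mkcond.
apply: eq_esum => j _; case: ifPn => // /negP ji; apply: fi.
by apply/eqP => /= jE; apply: ji; rewrite jE inE.
Qed.

Section branching_probabilities.
Context {R : realType} {d r : nat} (c : constants R d r).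
Hypothesis hc : standing_assumptions c.

Lemma qtotalE k : qtotal c k = (qsum c k)%:E.
Proof.
rewrite /qsum; have := pqd_sum1 hc k.
have : (0 <= qtotal c k)%E.
  by apply: esum_ge0 => lm _; rewrite lee_fin; case/andP: (qbranch_01 hc k lm.1 lm.2).
by case: (qtotal c k).
Qed.

Lemma qsum_ge0 k : 0 <= qsum c k.
Proof.
rewrite -lee_fin -qtotalE; apply: esum_ge0 => lm _.
by rewrite lee_fin; case/andP: (qbranch_01 hc k lm.1 lm.2).
Qed.

Lemma pqd_sum1_fin k : pflip c k + qsum c k + pdeath c k = 1.
Proof. by have := pqd_sum1 hc k; rewrite qtotalE => -[]. Qed.

Lemma qbranch_le_qsum k l m : qbranch c k l m <= qsum c k.
Proof.
rewrite -lee_fin -qtotalE.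
have q0 lm : (0 <= (qbranch c k lm.1 lm.2)%:E)%E.
  by rewrite lee_fin; case/andP: (qbranch_01 hc k lm.1 lm.2).
rewrite -[leLHS](@esum_set1 _ _ (l, m) (fun lm => (qbranch c k lm.1 lm.2)%:E)
  (q0 (l, m))) [leLHS]esum_mkcond.
by apply: le_esum => lm _; case: ifP => // _; exact: q0.

Qed.

End branching_probabilities.

(** Endpoints, and points outside [[0, 1]], are left free. This covers the flip, branch and death
    sets together, degenerate intervals included. *)
Lemma uniform_prob01_itv {R : realType} (A : set R) (x y : R) :
  measurable A -> 0 <= x -> x <= y -> y <= 1 ->
  `]x, y[ `<=` A -> A `&` `[0, 1] `<=` `[x, y] ->
  uniform_prob (@ltr01 R) A = (y - x)%:E.
Proof.
move=> mA x0 xy y1 xyA Axy; rewrite /uniform_prob integral_uniform_pdf.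
have mA01 : measurable (A `&` `[0%R, 1%R]) by exact: measurableI.
rewrite (eq_integral (fun=> 1%E)); last first.
  move=> z; rewrite inE/= in_itv/= => -[_ z01].
  by rewrite /uniform_pdf z01 subr0 invr1.
rewrite integral_cst// mul1e.
have mE b1 b2 : lebesgue_measure [set` Interval (BSide b1 x) (BSide b2 y)] = (y - x)%:E.
  rewrite lebesgue_measure_itv/= lte_fin; case: ltP => // yx.
  by rewrite (@le_anti _ _ x y) ?xy// subrr.
apply/eqP; rewrite eq_le; apply/andP; split.
  by rewrite -(mE true false) le_measure ?inE.
rewrite -(mE false true) le_measure ?inE// => z xyz; split; first exact: xyA.
by move: xyz; rewrite /= !in_itv/= => /andP[? ?]; lra.
Qed.

(** * Sigma-algebras attached to a label and to its descendants *)

Section tree_variables.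
Context {R : realType} {d r : nat} (c : constants R d r).
Hypothesis hc : standing_assumptions c.
Context {disp : measure_display} {Omega : measurableType disp}
  (P : probability Omega R).
Variables (E U : label -> {RV P >-> R}).
Variable Y : label -> Zd d -> Omega -> Zd d * Zd d.
Hypothesis hEUY : branching_variables c E U Y.

Let index : choiceType := (label + label + label * Zd d)%type.
Let G : index -> set_system Omega := generated E U Y.

Definition index_label (j : index) : label :=
  match j with inl (inl a) => a | inl (inr a) => a | inr (a, _) => a end.

Definition own (a : label) : set index := [set j | index_label j = a].
(** Labels are stored with their last entry first, so the descendants of [a] are the labels with
    suffix [a]. *)
Definition descendants (a : label) : set index :=
  [set j | exists b, index_label j = b ++ a].
Definition strict_descendants (a : label) : set index :=
  [set j | exists i, descendants (i :: a) j].

Lemma generated_measurable j A : G j A -> measurable A.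
Proof.
case: j => [[a|a]|[a k]] [B mB <-]; last exact: (Y_measurable hEUY).
all: by rewrite -[_ @^-1` _]setTI; exact: measurable_funP.
Qed.

Lemma generated_setI j : setI_closed (G j).
Proof.
by case: j => [[a|a]|[a k]] _ _ [B mB <-] [B' mB' <-]; exists (B `&` B') => //;
  exact: measurableI.
Qed.

Lemma generated_setT j : G j setT.
Proof. by case: j => [[a|a]|[a k]]; exists setT. Qed.

Lemma descendantsW i a : descendants (i :: a) `<=` descendants a.
Proof. by move=> j [b bj]; exists (rcons b i); rewrite cat_rcons. Qed.

Lemma own_descendants a : own a `<=` descendants a.
Proof. by move=> j ja; exists [::]. Qed.

Lemma strict_descendants_child i a :
  descendants (i :: a) `<=` strict_descendants a.
Proof. by move=> j h; exists i. Qed.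

Lemma own_strict_descendants a : own a `&` strict_descendants a = set0.
Proof.
apply/seteqP; split => // j [ja [i [b]]]; rewrite (ja : _ = _) => /(congr1 size).
by rewrite size_cat/=; lia.
Qed.

Lemma descendants_disjoint i i' a : i != i' ->
  descendants (i :: a) `&` descendants (i' :: a) = set0.
Proof.
move=> ii'; apply/seteqP; split => // j [[b bj] [b' bb']]; rewrite bj in bb'.
have sb : size b = size b' by move/(congr1 size): bb'; rewrite !size_cat/=; lia.
by move/eqP: bb'; rewrite eqseq_cat// eqseq_cons (negbTE ii')/= andbF.
Qed.

Local Notation Om D := (g_sigma_algebraType (\bigcup_(j in D) G j)).

Let measurable_id_Om D : measurable_fun setT (id : Omega -> Om D).
Proof.
exact: (@measurable_id_sub_salgebra _ Omega index G generated_measurable D).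
Qed.

Lemma measurable_id_sub_salgebraS (D D' : set index) : D `<=` D' ->
  measurable_fun setT (id : Om D' -> Om D).
Proof. by move=> DD' _ B mB; rewrite setTI; exact: (sub_salgebraS DD'). Qed.

Lemma measurable_E (D : set index) a : D (inl (inl a)) ->
  measurable_fun setT (E a : Om D -> R).
Proof.
move=> Da _ B mB; rewrite setTI; apply: sub_sigma_algebra.
by exists (inl (inl a)) => //; exists B.
Qed.

Lemma measurable_U (D : set index) a : D (inl (inr a)) ->
  measurable_fun setT (U a : Om D -> R).
Proof.
move=> Da _ B mB; rewrite setTI; apply: sub_sigma_algebra.
by exists (inl (inr a)) => //; exists B.
Qed.

Lemma measurable_Y (D : set index) a k (B : set (Zd d * Zd d)) :
  D (inr (a, k)) -> measurable (Y a k @^-1` B : set (Om D)).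
Proof.
by move=> Da; apply: sub_sigma_algebra; exists (inr (a, k)) => //; exists B.
Qed.

Variables (init : Zd d -> R) (force : Zd d -> R -> R).
Hypotheses (init_ge0 : forall k, 0 <= init k)
  (force_ge0 : forall k t, 0 <= force k t).
Hypothesis force_measurable : forall k, measurable_fun setT (force k).

(* Joint measurability in time and in the variables attached to the
   descendants of the label. *)
Definition adapted (W : label -> Zd d -> R -> Omega -> R) : Prop :=
  forall a k, measurable_fun setT (fun x : R * Om (descendants a) => W a k x.1 x.2).

Definition random_step (W : label -> Zd d -> R -> Omega -> R)
    (a : label) (k : Zd d) (t : R) (w : Omega) : R :=
  step c (fun a => E a w) (fun a => U a w) (fun a => Y a ^~ w) init force
    (fun a k t => W a k t w) a k t.

Lemma adapted_shift W a i l (f : R * Om (descendants a) -> R) : adapted W ->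
  measurable_fun setT f ->
  measurable_fun setT (fun x : R * Om (descendants a) => W (i :: a) l (f x) x.2).
Proof.
move=> aW mf.
have mp : measurable_fun setT (fun x : R * Om (descendants a) =>
    (f x, x.2 : Om (descendants (i :: a)))).
  apply: measurable_fun_pair => //.
  exact: (measurableT_comp
    (measurable_id_sub_salgebraS (@descendantsW i a)) measurable_snd).
exact: (measurableT_comp (aW _ _) mp).
Qed.

Lemma adapted_step W : adapted W -> adapted (random_step W).
Proof.
move=> aW a k; rewrite /random_step /step.
have own_a j : index_label j = a -> descendants a j.
  by move=> ja; exact: own_descendants.
have mE : measurable_fun setT (fun x : R * Om (descendants a) => E a x.2).
  by apply: (measurableT_comp (measurable_E _)) => //; exact: own_a.
have mU : measurable_fun setT (fun x : R * Om (descendants a) => U a x.2).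
  by apply: (measurableT_comp (measurable_U _)) => //; exact: own_a.
have ml : measurable_fun setT (fun x : R * Om (descendants a) =>
    lifetime c (fun a => E a x.2) a k).
  exact: measurable_funM.
have ms : measurable_fun setT (fun x : R * Om (descendants a) =>
    x.1 - lifetime c (fun a => E a x.2) a k).
  exact: measurable_funB.
have mB : measurable_fun setT (fun x : R * Om (descendants a) =>
    may_branch c (fun a => U a x.2) a k).
  by apply: measurable_and; exact: measurable_fun_ler.
have mF : measurable_fun setT (fun x : R * Om (descendants a) =>
    may_flip c (fun a => U a x.2) a k).
  by apply: measurable_and; exact: measurable_fun_ler.
apply: measurable_fun_ifT => //; first exact: measurable_fun_ler.
apply: measurable_fun_ifT => //.
  apply: measurable_fun_ifT => //.
  by apply: measurable_funM => //; exact: adapted_shift.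
apply: measurable_fun_ifT => //; last exact: measurableT_comp.
apply: measurable_funM => //.
(* The children sit at random positions, while adaptedness of [W] concerns fixed ones. *)
apply: (@measurable_fun_select _ _ _ _ _ (fun x : R * Om (descendants a) => Y a k x.2)
   (fun lm x => W (i1 :: a) lm.1 (x.1 - lifetime c (fun a => E a x.2) a k) x.2 *
     W (i2 :: a) lm.2 (x.1 - lifetime c (fun a => E a x.2) a k) x.2)).
  move=> lm; rewrite (_ : _ @^-1` _ = setT `*` (Y a k @^-1` [set lm])).
    apply: measurableX => //; apply: measurable_Y; exact: own_a.
  by apply/seteqP; split => [[t w]|[t w] []].
by move=> lm; apply: measurable_funM; exact: adapted_shift.
Qed.

(* The variables in K (used through C), the clock E a and the strict descendants
   of a are independent, so the integral factorizes by Fubini; the law of the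
   remaining time t - E a / lambda on [0, t] has density
   lambda exp (- lambda (t - s)). *)
Lemma expectation_clock a k (C : set Omega) (K : set index) t
    (h : R * Om (strict_descendants a) -> \bar R) :
  0 <= t -> K `<=` own a -> ~ K (inl (inl a)) ->
  <<s \bigcup_(j in K) G j >> C ->
  measurable_fun setT h -> (forall x, 0 <= h x)%E ->
  (\int[P]_w ((\1_C w)%:E *
     (if (lifetime c (fun a => E a w) a k < t)%R
      then h ((t - lifetime c (fun a => E a w) a k)%R, w) else 0)) =
   P C * \int[@lebesgue_measure R]_(s in `[0%R, t])
     ((lambda c k * expR (- (lambda c k * (t - s))))%:E * \int[P]_w h (s, w)))%E.
Proof.
move=> t0 Ka KE sC mh h0.
have lam0 := lambda_gt0 hc k.
have mC := sub_salgebra_measurable generated_measurable sC.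
pose hbar s := (\int[P]_w h (s, w))%E.
pose h' (x : R * Omega) : \bar R := h x.
have mh' : measurable_fun setT h'.
  have mp : measurable_fun setT (fun x : R * Omega =>
      (x.1, x.2 : Om (strict_descendants a))).
    apply: measurable_fun_pair => //.
    have mid := @measurable_id_Om (strict_descendants a).
    exact: (measurableT_comp mid measurable_snd).
  by apply: (eq_measurable_fun _ _ (measurableT_comp mh mp)) => -[s w] _.
have mhbar : measurable_fun setT hbar.
  exact: (@measurable_fun_fubini_tonelli_F _ _ _ _ _ P h' mh').
have mhs s : measurable_fun setT (fun w : Omega => h (s, w)).
  have mp : measurable_fun setT (fun w : Omega => (s, w)).
    by apply: measurable_fun_pair.
  exact: (measurableT_comp mh' mp).
have hbar0 s : (0 <= hbar s)%E by exact: integral_ge0.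
pose g x :=
  (if ((lambda c k)^-1 * x < t)%R then hbar (t - (lambda c k)^-1 * x)%R else 0)%E.
have mg : measurable_fun setT g.
  apply: measurable_fun_ifT => //; first exact: measurable_fun_ltr.
  by apply: (measurableT_comp mhbar); exact: measurable_funB.
have g0 x : (0 <= g x)%E by rewrite /g; case: ifP.
(* First separation: the variables at [a] are frozen while those strictly below are integrated,
   which produces [hbar] at the remaining time. *)
pose H1 (x : Om (own a) * Om (strict_descendants a)) := ((\1_C x.1)%:E *
  (if ((lambda c k)^-1 * E a x.1 < t)%R
   then h ((t - (lambda c k)^-1 * E a x.1)%R, x.2) else 0))%E.
have ownE : own a (inl (inl a)) by [].
have mE1 : measurable_fun setT (fun x : Om (own a) * Om (strict_descendants a) =>
    (lambda c k)^-1 * E a x.1).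
  by apply: measurable_funM => //; exact: (measurableT_comp (measurable_E ownE)).
have mH1 : measurable_fun setT H1.
  apply: emeasurable_funM.
    apply/measurable_EFinP.
    apply: (measurableT_comp (f := \1_C : Om (own a) -> R)) => //.
    by apply: measurable_indic; exact: (sub_salgebraS Ka).
  apply: measurable_fun_ifT => //; first exact: measurable_fun_ltr.
  apply: (measurableT_comp mh); apply: measurable_fun_pair => //.
  exact: measurable_funB.
have H10 x : (0 <= H1 x)%E.
  by rewrite /H1; apply: mule_ge0; [rewrite lee_fin|case: ifP].
transitivity (\int[P]_w H1 (w, w))%E; first by [].
rewrite (integral_independent generated_measurable generated_setI generated_setT
  (EUY_independent hEUY) (own_strict_descendants a) mH1 H10).
(* Second separation, among the variables at [a]: the event [C] against the clock. *)
pose H2 (x : Om K * Om [set inl (inl a)]) := ((\1_C x.1)%:E * g (E a x.2))%E.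
have mH2 : measurable_fun setT H2.
  apply: emeasurable_funM.
    apply/measurable_EFinP.
    by apply: (measurableT_comp (f := \1_C : Om K -> R)) => //; exact: measurable_indic.
  apply: (measurableT_comp mg).
  apply: (measurableT_comp (f := E a : Om [set inl (inl a)] -> R)) => //.
  exact: measurable_E.
have H20 x : (0 <= H2 x)%E by rewrite /H2 mule_ge0.
transitivity (\int[P]_w H2 (w, w))%E.
  apply: eq_integral => w _; rewrite /H1 /H2 /g /=.
  case: ifP => _; last by rewrite mule0 integral0_eq// => x _; rewrite mule0.
  by rewrite ge0_integralZl//; exact: mhs.
have dK : K `&` [set inl (inl a)] = set0.
  by apply/seteqP; split => // j [/[swap] ->].
rewrite (integral_independent generated_measurable generated_setI generated_setT
  (EUY_independent hEUY) dK mH2 H20).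
have -> : (\int[P]_w \int[P]_w' H2 (w, w') =
    \int[P]_w ((\1_C w)%:E * \int[P]_w' g (E a w')))%E.
  apply: eq_integral => w _; rewrite /H2/= ge0_integralZl//.
  exact: measurableT_comp.
rewrite ge0_integralZr//; last 2 first.
- exact/measurable_EFinP/measurable_indic.
- exact: integral_ge0.
rewrite integral_indic// setIT; congr (_ * _)%E.
have mEa : measurable_fun setT (E a : Omega -> measurableTypeR R).
  by move=> _ B mB; apply: (measurable_funP (E a)).
pose E' : {mfun Omega >-> measurableTypeR R} :=
  HB.pack (E a : Omega -> measurableTypeR R) (isMeasurableFun.Build _ _ _ _ _ mEa).
transitivity (\int[distribution P E']_x g x)%E.
  by rewrite ge0_integral_distribution.
rewrite (@eq_measure_integral _ _ _ _ (exponential_prob 1)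
  (distribution P E')); last first.
  by move=> A mA _; exact: (E_law hEUY a mA).
by rewrite ge0_integral_exponential_clock.
Qed.

(** The overlap of the two closed intervals, where [step] returns 0, is removed from both. As
    [p + q + d = 1], it is at most one point, present only if [d = 0]. *)
Let flip_set k : set R := `[0, pflip c k] `\` `[1 - qsum c k, 1].
Let branch_set k : set R := `[1 - qsum c k, 1] `\` `[0, pflip c k].
Let death_set k : set R := ~` (`[0, pflip c k] `|` `[1 - qsum c k, 1]).

Let measurable_flip_set k : measurable (flip_set k).
Proof. exact: measurableD. Qed.

Let measurable_branch_set k : measurable (branch_set k).
Proof. exact: measurableD. Qed.

Let measurable_death_set k : measurable (death_set k).
Proof. by apply: measurableC; exact: measurableU. Qed.

Let pqd k : [/\ 0 <= pflip c k, pflip c k <= 1, 0 <= qsum c k, 0 <= pdeath c k &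
  pflip c k + qsum c k + pdeath c k = 1].
Proof.
split; [| |exact: qsum_ge0| |exact: pqd_sum1_fin].
- by have /andP[] := pflip_01 hc k.
- by have /andP[] := pflip_01 hc k.
- by have /andP[] := pdeath_01 hc k.
Qed.

Let P_U a A : measurable A -> P (U a @^-1` A) = uniform_prob (@ltr01 R) A.
Proof. exact: (U_law hEUY). Qed.

Let P_flip_set a k : P (U a @^-1` flip_set k) = (pflip c k)%:E.
Proof.
have [p0 p1 q0 d0 s1] := pqd k.
rewrite P_U// (@uniform_prob01_itv _ _ 0 (pflip c k)) ?subr0//.
- move=> x; rewrite /flip_set/= !in_itv/= => /andP[x0 xp]; split.
    by rewrite !ltW.
  by move=> /andP[qx _]; lra.
- by move=> x [[+ _] _]; rewrite /= !in_itv.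
Qed.

Let P_branch_set a k : P (U a @^-1` branch_set k) = (qsum c k)%:E.
Proof.
have [p0 p1 q0 d0 s1] := pqd k.
rewrite P_U// (@uniform_prob01_itv _ _ (1 - qsum c k) 1) ?subKr//; try lra.
- move=> x; rewrite /branch_set/= !in_itv/= => /andP[x0 xp]; split.
    by rewrite !ltW.
  by move=> /andP[_ qx]; lra.
- by move=> x [[+ _] _]; rewrite /= !in_itv.
Qed.

Let P_death_set a k : P (U a @^-1` death_set k) = (pdeath c k)%:E.
Proof.
have [p0 p1 q0 d0 s1] := pqd k.
have pq : pflip c k <= 1 - qsum c k by lra.
have q1 : 1 - qsum c k <= 1 by lra.
have -> : pdeath c k = 1 - qsum c k - pflip c k by lra.
rewrite P_U// (@uniform_prob01_itv _ _ (pflip c k) (1 - qsum c k))//.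
- move=> x; rewrite /death_set/= !in_itv/= => /andP[px xq].
  by case=> /andP[]; lra.
- move=> x [+ +]; rewrite /death_set/= !in_itv/= => + /andP[x0 x1].
  move=> /not_orP[/negP + /negP]; rewrite x0 x1/= andbT -!ltNge => *.
  by apply/andP; split; apply: ltW.
Qed.

Let P_branch_to a k l m :
  P (U a @^-1` branch_set k `&` Y a k @^-1` [set (l, m)]) = (qbranch c k l m)%:E.
Proof.
have mA : <<s \bigcup_(j in [set inl (inr a)]) G j >> (U a @^-1` branch_set k).
  by apply: sub_sigma_algebra; exists (inl (inr a)) => //; exists (branch_set k).
have mB : <<s \bigcup_(j in [set inr (a, k)]) G j >> (Y a k @^-1` [set (l, m)]).
  by apply: sub_sigma_algebra; exists (inr (a, k)) => //; exists [set (l, m)].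
rewrite (indep_sub_salgebra generated_measurable generated_setI generated_setT
  (EUY_independent hEUY) _ mA mB); last by apply/seteqP; split => // j [/= ->].
(* If the total branching probability is 0, the law of [Y] is arbitrary, but the event is null and
   each [qbranch] is bounded by that total. *)
rewrite P_branch_set; have := qsum_ge0 hc k; rewrite le_eqVlt => /predU1P[q0|q0].
  have := qbranch_le_qsum hc k l m; rewrite -q0 mul0e => h; congr _%:E.
  by apply/le_anti; rewrite h; case/andP: (qbranch_01 hc k l m) => ->.
have -> : Y a k @^-1` [set (l, m)] = [set w | (Y a k w).1 = l /\ (Y a k w).2 = m].
  by apply/seteqP; split => w /=; [move=> ->|case: (Y a k w) => ? ? /= [-> ->]].
by rewrite (Y_law hEUY)// -EFinM mulrC divfK// gt_eqF.
Qed.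

Let P_alive a k t : 0 <= t ->
  P [set w | t <= lifetime c (fun a => E a w) a k] = (expR (- (lambda c k * t)))%:E.
Proof.
move=> t0; have l0 := lambda_gt0 hc k.
have -> : [set w | t <= lifetime c (fun a => E a w) a k] =
    ~` (E a @^-1` `]-oo, lambda c k * t[).
  apply/seteqP; split => w /=; rewrite in_itv/= /lifetime ler_pdivlMl//.
    by rewrite ltNge => ->.
  by move/negP; rewrite -leNgt.
rewrite probability_setC; last first.
  by rewrite -[_ @^-1` _]setTI; exact: measurable_funP.
have := E_law hEUY a (measurable_itv `]-oo, lambda c k * t[).
rewrite exponential_prob_itvNyo; last by rewrite mulr_ge0// ltW.
rewrite /distribution/= /pushforward => ->.
transitivity (1 - (1 - expR (- (lambda c k * t))))%:E => //; congr _%:E; ring.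
Qed.

(** The Duhamel form of (C), with values in [\bar R] so that it makes sense before any expectation
    is known to be finite. *)
Definition picard (v : Zd d -> R -> \bar R) (k : Zd d) (t : R) : \bar R :=
  ((expR (- (lambda c k * t)) * init k)%:E +
   \int[@lebesgue_measure R]_(s in `[0%R, t])
     ((lambda c k * expR (- (lambda c k * (t - s))))%:E *
      ((Cflip c * pflip c k)%:E * v k s +
       (Cbranch c)%:E * (\esum_(lm in [set: Zd d * Zd d])
          ((qbranch c k lm.1 lm.2)%:E * (v lm.1 s * v lm.2 s))) +
       (pdeath c k * force k s)%:E)))%E.

(** * The expectation of one step of the recursion *)

Section expectation_step.
Variables (W : label -> Zd d -> R -> Omega -> R) (v : Zd d -> R -> \bar R).
Hypotheses (adW : adapted W) (W0 : forall a k t w, 0 <= W a k t w).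
(** The same [v] serves all labels, which takes the place of the equality in law of the subtrees
    when passing from [a] to its children. *)
Hypothesis EW : forall a k s, 0 <= s -> (\int[P]_w (W a k s w)%:E = v k s)%E.
Variables (a : label) (k : Zd d) (t : R).
Hypothesis t0 : 0 <= t.

Local Notation tau w := (lifetime c (fun a => E a w) a k).
Local Notation K s := ((lambda c k * expR (- (lambda c k * (t - s))))%:E).

Let K0 s : (0 <= K s)%E.
Proof. by rewrite lee_fin mulr_ge0 ?expR_ge0// ltW// (lambda_gt0 hc). Qed.

Let mK : measurable_fun `[0, t] (fun s => K s).
Proof.
apply/measurable_EFinP/measurable_funTS; apply: measurable_funM => //.
apply: measurableT_comp => //; apply: measurableT_comp => //.
by apply: measurable_funM => //; exact: measurable_funB.
Qed.

Let adapted_strict i l :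
  measurable_fun setT (fun x : R * Om (strict_descendants a) => W (i :: a) l x.1 x.2).
Proof.
have mp : measurable_fun setT (fun x : R * Om (strict_descendants a) =>
    (x.1, x.2 : Om (descendants (i :: a)))).
  apply: measurable_fun_pair => //.
  exact: (measurableT_comp
    (measurable_id_sub_salgebraS (@strict_descendants_child i a)) measurable_snd).
exact: (measurableT_comp (@adW (i :: a) l) mp).
Qed.

Let adapted_section b l s :
  measurable_fun setT (W b l s : Om (descendants b) -> R).
Proof.
have mp : measurable_fun setT (fun w : Om (descendants b) => (s, w)).
  exact: measurable_fun_pair.
exact: (measurableT_comp (@adW b l) mp).
Qed.

Let W_measurable b l s : measurable_fun setT (W b l s).
Proof.
have mid := @measurable_id_Om (descendants b).
exact: (measurableT_comp (@adapted_section b l s) mid).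
Qed.

Let v0 l s : 0 <= s -> (0 <= v l s)%E.
Proof.
by move=> s0; rewrite -(EW [::] _ s0) integral_ge0// => w _; rewrite lee_fin.
Qed.

(** A partial integral of a jointly measurable function; the label [[::]] is an arbitrary choice,
    and [EW] says nothing at negative times. *)
Let mv l : measurable_fun `[0, t] (v l).
Proof.
have mW : measurable_fun setT (fun x : R * Omega => (W [::] l x.1 x.2)%:E).
  apply/measurable_EFinP.
  have mp : measurable_fun setT (fun x : R * Omega =>
      (x.1, x.2 : Om (descendants [::]))).
    apply: measurable_fun_pair => //.
    have mid := @measurable_id_Om (descendants [::]).
    exact: (measurableT_comp mid measurable_snd).
  exact: (measurableT_comp (@adW [::] l) mp).
have W0' x : (0 <= (W [::] l x.1 x.2)%:E)%E by rewrite lee_fin.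
have mF := @measurable_fun_fubini_tonelli_F _ _ _ _ _ P _ mW W0'.
apply: eq_measurable_fun (measurable_funTS mF) => s.
by rewrite inE/= in_itv/= => /andP[s0 _]; rewrite /fubini_F EW.
Qed.

Let expectation_product l m s : 0 <= s ->
  (\int[P]_w ((W (i1 :: a) l s w)%:E * (W (i2 :: a) m s w)%:E) = v l s * v m s)%E.
Proof.
move=> s0.
pose H (x : Om (descendants (i1 :: a)) * Om (descendants (i2 :: a))) :=
  ((W (i1 :: a) l s x.1)%:E * (W (i2 :: a) m s x.2)%:E)%E.
have mH : measurable_fun setT H.
  apply: emeasurable_funM; apply/measurable_EFinP.
    exact: (measurableT_comp (@adapted_section (i1 :: a) l s) measurable_fst).
  exact: (measurableT_comp (@adapted_section (i2 :: a) m s) measurable_snd).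
have H0 x : (0 <= H x)%E by rewrite /H mule_ge0// lee_fin.
transitivity (\int[P]_w H (w, w))%E; first by [].
have dis : descendants (i1 :: a) `&` descendants (i2 :: a) = set0.
  exact: descendants_disjoint.
rewrite (integral_independent generated_measurable generated_setI generated_setT
  (EUY_independent hEUY) dis mH H0).
transitivity (\int[P]_w ((W (i1 :: a) l s w)%:E * v m s))%E.
  apply: eq_integral => w _; rewrite /H/= ge0_integralZl//.
  - by rewrite EW.
  - exact/measurable_EFinP/W_measurable.
  - by move=> x _; rewrite lee_fin.
  - by rewrite lee_fin.
rewrite ge0_integralZr ?EW//.
- exact/measurable_EFinP/W_measurable.
- by move=> x _; rewrite lee_fin.
- exact: v0.
Qed.

Let clock_term (C : set Omega) (x : R -> Omega -> \bar R) w : \bar R :=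
  ((\1_C w)%:E * (if (tau w < t)%R then x (t - tau w)%R w else 0))%E.

Let flip_event := U a @^-1` flip_set k.
Let death_event := U a @^-1` death_set k.
Let branch_event (lm : Zd d * Zd d) :=
  U a @^-1` branch_set k `&` Y a k @^-1` [set lm].
Let flip_value s w := (Cflip c * W (i0 :: a) k s w)%:E.
Let branch_value (lm : Zd d * Zd d) s w :=
  (Cbranch c * (W (i1 :: a) lm.1 s w * W (i2 :: a) lm.2 s w))%:E.

Let initial_term w : \bar R := ((if t <= tau w then init k else 0)%R)%:E.

Let flip_eventE w : (w \in flip_event) =
  may_flip c (fun a => U a w) a k && ~~ may_branch c (fun a => U a w) a k.
Proof.
apply/idP/andP; rewrite inE /flip_event /flip_set /may_flip /may_branch /= !in_itv/=.
  by move=> [? /negP].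
by move=> [? /negP].
Qed.

Let branch_eventE lm w : (w \in branch_event lm) =
  [&& ~~ may_flip c (fun a => U a w) a k, may_branch c (fun a => U a w) a k &
      Y a k w == lm].
Proof.
apply/idP/and3P; rewrite inE /branch_event /branch_set /may_flip /may_branch /= !in_itv/=.
  by move=> [[? /negP ?] ->].
by move=> [/negP ? ? /eqP].
Qed.

Let death_eventE w : (w \in death_event) =
  ~~ may_flip c (fun a => U a w) a k && ~~ may_branch c (fun a => U a w) a k.
Proof.
apply/idP/andP; rewrite inE /death_event /death_set /may_flip /may_branch /= !in_itv/=.
  by move=> /not_orP[/negP ? /negP ?].
by move=> [/negP ? /negP ?] [].
Qed.

(** The branch is expanded over all pairs of child positions, of which only the pair realised by [Y]
    can contribute. Each term then has deterministic positions and an event that does not involve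
    the clock, as [expectation_clock] requires. *)
Let random_stepE w : ((random_step W a k t w)%:E =
  initial_term w + clock_term flip_event flip_value w +
  \esum_(lm in [set: Zd d * Zd d]) clock_term (branch_event lm) (branch_value lm) w +
  clock_term death_event (fun s _ => (force k s)%:E) w)%E.
Proof.
rewrite /random_step /step /initial_term /clock_term; case: ltP => [lt_t|_]; last first.
  by rewrite !mule0 !adde0 esum1 ?adde0// => lm _; rewrite mule0.
under eq_esum do rewrite indicE branch_eventE.
rewrite add0e !indicE flip_eventE death_eventE.
case: ifPn => f; case: ifPn => b /=; rewrite ?mul0e ?mul1e ?adde0 ?add0e.
- by rewrite esum1// => lm _; rewrite mul0e.
- by rewrite esum1 ?adde0// => lm _; rewrite mul0e.
- rewrite (esum_single (i := Y a k w)); last 2 first.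
  + by rewrite eqxx mul1e lee_fin !mulr_ge0// (Cbranch_ge0 hc).
  + by move=> lm; rewrite eq_sym => /negbTE ->; rewrite mul0e.
  by rewrite eqxx mul1e.
- by rewrite esum1 ?add0e// => lm _; rewrite mul0e.
Qed.

Let expectation_clock_term (C : set Omega) (L : set index) (x : R -> Omega -> R) :
  L `<=` own a -> ~ L (inl (inl a)) -> <<s \bigcup_(j in L) G j >> C ->
  measurable_fun setT (fun z : R * Om (strict_descendants a) => x z.1 z.2) ->
  (forall s w, 0 <= x s w) ->
  (\int[P]_w clock_term C (fun s w => (x s w)%:E) w = P C *
   \int[@lebesgue_measure R]_(s in `[0%R, t]) (K s * \int[P]_w (x s w)%:E))%E.
Proof.
move=> La LE sC mx x0.
rewrite -(expectation_clock (h := fun z => (x z.1 z.2)%:E) k t0 La LE sC)//.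
- exact/measurable_EFinP.
- by move=> z; rewrite lee_fin.
Qed.

Let measurable_clock_term (C : set Omega) (x : R -> Omega -> R) :
  measurable C ->
  measurable_fun setT (fun z : R * Om (strict_descendants a) => x z.1 z.2) ->
  measurable_fun setT (clock_term C (fun s w => (x s w)%:E)).
Proof.
move=> mC mx; apply: emeasurable_funM; first exact/measurable_EFinP/measurable_indic.
have mtau : measurable_fun setT (fun w => tau w) by exact: measurable_funM.
apply: measurable_fun_ifT => //; first exact: measurable_fun_ltr.
apply/measurable_EFinP.
have mp : measurable_fun setT (fun w : Omega =>
    (t - tau w, w : Om (strict_descendants a))).
  apply: measurable_fun_pair; first exact: measurable_funB.
  exact: measurable_id_Om.
exact: (measurableT_comp mx mp).
Qed.

Let clock_term_ge0 C (x : R -> Omega -> R) w : (forall s w, 0 <= x s w) ->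
  (0 <= clock_term C (fun s w => (x s w)%:E) w)%E.
Proof.
move=> x0; apply: mule_ge0; first by rewrite lee_fin.
by case: ifP => // _; rewrite lee_fin.
Qed.

Let measurable_flip_value :
  measurable_fun setT (fun z : R * Om (strict_descendants a) =>
    Cflip c * W (i0 :: a) k z.1 z.2).
Proof. exact: measurable_funM. Qed.

Let measurable_branch_value (lm : Zd d * Zd d) :
  measurable_fun setT (fun z : R * Om (strict_descendants a) =>
    Cbranch c * (W (i1 :: a) lm.1 z.1 z.2 * W (i2 :: a) lm.2 z.1 z.2)).
Proof. by apply: measurable_funM => //; exact: measurable_funM. Qed.

Let measurable_death_value :
  measurable_fun setT (fun z : R * Om (strict_descendants a) => force k z.1).
Proof. exact: measurableT_comp. Qed.

Let flip_value_ge0 s w : 0 <= Cflip c * W (i0 :: a) k s w.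
Proof. by rewrite mulr_ge0// (Cflip_ge0 hc). Qed.

Let branch_value_ge0 lm s w :
  0 <= Cbranch c * (W (i1 :: a) lm.1 s w * W (i2 :: a) lm.2 s w).
Proof. by rewrite !mulr_ge0// (Cbranch_ge0 hc). Qed.

Let event_U (S : set R) : measurable S ->
  <<s \bigcup_(j in [set inl (inr a)]) G j >> (U a @^-1` S).
Proof.
by move=> mS; apply: sub_sigma_algebra; exists (inl (inr a)) => //; exists S.
Qed.

Let own_U : [set inl (inr a)] `<=` own a. Proof. by move=> j /= ->. Qed.

Let not_own_E : ~ [set inl (inr a)] (inl (inl a) : index). Proof. by []. Qed.

Let own_UY : own a `\ inl (inl a) `<=` own a. Proof. by move=> j []. Qed.

Let not_own_E' : ~ (own a `\ inl (inl a)) (inl (inl a) : index).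
Proof. by case=> _; apply. Qed.

Let event_UY lm : <<s \bigcup_(j in own a `\ inl (inl a)) G j >> (branch_event lm).
Proof.
apply: (@measurableI _ (Om (own a `\ inl (inl a)))); apply: sub_sigma_algebra.
  by exists (inl (inr a)) => //; exists (branch_set k).
exists (inr (a, k)) => //. by exists [set lm].
Qed.

Let expectation_initial :
  (\int[P]_w initial_term w = (expR (- (lambda c k * t)) * init k)%:E)%E.
Proof.
have mA : measurable [set w | t <= tau w].
  rewrite -[X in measurable X]setTI; apply: (measurable_fun_ler (f := cst t)) => //.
  exact: measurable_funM.
rewrite EFinM muleC -(P_alive a k t0) -[X in (_ * P X)%E]setIT -integral_indic//.
rewrite -ge0_integralZl//; last 2 first.
- exact/measurable_EFinP/measurable_indic.
- by rewrite lee_fin.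
apply: eq_integral => w _; rewrite /initial_term indicE -EFinM; congr _%:E.
case: ifPn => h; first by rewrite mem_set// mulr1.
by rewrite memNset ?mulr0//=; exact/negP.
Qed.

Let expectation_flip :
  (\int[P]_w clock_term flip_event flip_value w =
  \int[@lebesgue_measure R]_(s in `[0%R, t])
    (K s * ((Cflip c * pflip c k)%:E * v k s)))%E.
Proof.
have Cf0 := Cflip_ge0 hc; have [p0 _ _ _ _] := pqd k.
rewrite (expectation_clock_term own_U not_own_E (event_U _) measurable_flip_value)//.
transitivity ((pflip c k)%:E * \int[@lebesgue_measure R]_(s in `[0%R, t])
    (K s * ((Cflip c)%:E * v k s)))%E.
  rewrite -(P_flip_set a); congr (_ * _)%E; apply: eq_integral => s.
  rewrite inE/= in_itv/= => /andP[s0 _].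
  under eq_integral do rewrite EFinM.
  rewrite ge0_integralZl ?EW//; first exact/measurable_EFinP/W_measurable.
  by move=> w _; rewrite lee_fin.
rewrite -ge0_integralZl//.
- apply: eq_integral => s _; rewrite muleCA; congr (_ * _)%E.
  by rewrite muleA -EFinM [_ * Cflip c]mulrC.
- by apply: emeasurable_funM; [exact: mK|apply: measurable_funeM; exact: mv].
- move=> s /=; rewrite in_itv/= => /andP[s0 _].
  by rewrite mule_ge0// mule_ge0// v0.
Qed.

Let expectation_death :
  (\int[P]_w clock_term death_event (fun s _ => (force k s)%:E) w =
  \int[@lebesgue_measure R]_(s in `[0%R, t])
    (K s * (pdeath c k * force k s)%:E))%E.
Proof.
have [_ _ _ d0 _] := pqd k.
rewrite (expectation_clock_term own_U not_own_E (event_U _) measurable_death_value)//.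
rewrite -/death_event P_death_set -ge0_integralZl//.
- apply: eq_integral => s _; rewrite integral_cst//= probability_setT mule1.
  by rewrite muleCA EFinM.
- apply: emeasurable_funM; first exact: mK.
  apply: (eq_measurable_fun (fun s => (force k s)%:E)).
    by move=> s _; rewrite integral_cst//= probability_setT mule1.
  by apply/measurable_EFinP/measurable_funTS.
- by move=> s _; rewrite mule_ge0// integral_ge0// => w _; rewrite lee_fin.
Qed.

Let branch_sum s := (\esum_(lm in [set: Zd d * Zd d])
  ((qbranch c k lm.1 lm.2)%:E * (v lm.1 s * v lm.2 s)))%E.

Let q0 (lm : Zd d * Zd d) : 0 <= qbranch c k lm.1 lm.2.
Proof. by case/andP: (qbranch_01 hc k lm.1 lm.2). Qed.

Let vv0 (lm : Zd d * Zd d) s : 0 <= s -> (0 <= v lm.1 s * v lm.2 s)%E.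
Proof. by move=> s0; rewrite mule_ge0// v0. Qed.

Let mvv (lm : Zd d * Zd d) : measurable_fun `[0, t] (fun s => v lm.1 s * v lm.2 s)%E.
Proof. by apply: emeasurable_funM; exact: mv. Qed.

Let qvv0 (lm : Zd d * Zd d) s : 0 <= s ->
  (0 <= (qbranch c k lm.1 lm.2)%:E * (v lm.1 s * v lm.2 s))%E.
Proof. by move=> s0; rewrite mule_ge0 ?lee_fin// vv0. Qed.

(** The sum over positions leaves the expectation, each term factorizes, and the sum returns inside
    the time integral; both exchanges hold because all terms are nonnegative. *)
Let expectation_branch :
  (\int[P]_w (\esum_(lm in [set: Zd d * Zd d])
      clock_term (branch_event lm) (branch_value lm) w) =
  \int[@lebesgue_measure R]_(s in `[0%R, t]) (K s * ((Cbranch c)%:E * branch_sum s)))%E.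
Proof.
have Cb0 := Cbranch_ge0 hc.
rewrite ge0_integral_esum//; last 2 first.
- move=> lm.
  have mE := sub_salgebra_measurable generated_measurable (event_UY lm).
  exact: (@measurable_clock_term _ (fun s w => Cbranch c *
    (W (i1 :: a) lm.1 s w * W (i2 :: a) lm.2 s w)) mE (measurable_branch_value lm)).
- by move=> lm w _; exact: clock_term_ge0.
transitivity (\esum_(lm in [set: Zd d * Zd d])
  \int[@lebesgue_measure R]_(s in `[0%R, t])
    (K s * ((Cbranch c)%:E * ((qbranch c k lm.1 lm.2)%:E * (v lm.1 s * v lm.2 s)))))%E.
  apply: eq_esum => -[l m] _.
  rewrite (expectation_clock_term own_UY not_own_E' (event_UY _)
    (measurable_branch_value _))//.
  transitivity ((qbranch c k l m)%:E * \int[@lebesgue_measure R]_(s in `[0%R, t])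
      (K s * ((Cbranch c)%:E * (v l s * v m s))))%E.
    rewrite -(P_branch_to a); congr (_ * _)%E.
    apply: eq_integral => s; rewrite inE/= in_itv/= => /andP[s0 _].
    under eq_integral do rewrite EFinM EFinM.
    rewrite ge0_integralZl//.
    + by rewrite expectation_product.
    + by apply: emeasurable_funM; exact/measurable_EFinP/W_measurable.
    + by move=> w _; rewrite mule_ge0// lee_fin.
  rewrite -ge0_integralZl//.
  - by apply: eq_integral => s _; rewrite muleCA; congr (_ * _)%E; rewrite muleCA.
  - apply: emeasurable_funM; first exact: mK.
    by apply: measurable_funeM; exact: (mvv (l, m)).
  - move=> s /=; rewrite in_itv/= => /andP[s0 _].
    by rewrite mule_ge0// mule_ge0// (vv0 (l, m)).
  - by rewrite lee_fin; exact: (q0 (l, m)).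
rewrite -ge0_integral_esum//.
- apply: eq_integral => s; rewrite inE/= in_itv/= => /andP[s0 _].
  have l0 : 0 <= lambda c k * expR (- (lambda c k * (t - s))).
    by have := K0 s; rewrite lee_fin.
  rewrite esumZl//; last by move=> lm; rewrite mule_ge0// qvv0.
  by congr (_ * _)%E; rewrite esumZl// => lm; rewrite qvv0.
- move=> lm; apply: emeasurable_funM; first exact: mK.
  by do 2 apply: measurable_funeM; exact: mvv.
- move=> lm s /=; rewrite in_itv/= => /andP[s0 _].
  by rewrite mule_ge0// mule_ge0// qvv0.
Qed.

Lemma expectation_step : (\int[P]_w (random_step W a k t w)%:E = picard v k t)%E.
Proof.
have [p0 _ _ d0 _] := pqd k.
have Cf0 := Cflip_ge0 hc; have Cb0 := Cbranch_ge0 hc.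
have fin_event S : measurable S -> measurable (U a @^-1` S).
  by move=> mS; exact: (sub_salgebra_measurable generated_measurable (event_U mS)).
have mI : measurable_fun setT initial_term.
  apply/measurable_EFinP; apply: measurable_fun_ifT => //.
  by apply: measurable_fun_ler => //; exact: measurable_funM.
have I0 w : (0 <= initial_term w)%E.
  by rewrite /initial_term lee_fin; case: ifP.
have mF : measurable_fun setT (clock_term flip_event flip_value).
  exact: (@measurable_clock_term _ (fun s w => Cflip c * W (i0 :: a) k s w)
    (fin_event _ (measurable_flip_set k)) measurable_flip_value).
have F0 w : (0 <= clock_term flip_event flip_value w)%E.
  exact: clock_term_ge0.
have mD : measurable_fun setT (clock_term death_event (fun s _ => (force k s)%:E)).
  exact: (@measurable_clock_term _ (fun s w => force k s)
    (fin_event _ (measurable_death_set k)) measurable_death_value).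
have D0 w : (0 <= clock_term death_event (fun s _ => (force k s)%:E) w)%E.
  exact: clock_term_ge0.
have B0 lm w : (0 <= clock_term (branch_event lm) (branch_value lm) w)%E.
  exact: clock_term_ge0.
have mB : measurable_fun setT (fun w => \esum_(lm in [set: Zd d * Zd d])
    clock_term (branch_event lm) (branch_value lm) w).
  apply: measurable_fun_esum => // lm.
  have mE := sub_salgebra_measurable generated_measurable (event_UY lm).
  exact: (@measurable_clock_term _ (fun s w => Cbranch c *
    (W (i1 :: a) lm.1 s w * W (i2 :: a) lm.2 s w)) mE (measurable_branch_value lm)).
have S0 w : (0 <= \esum_(lm in [set: Zd d * Zd d])
    clock_term (branch_event lm) (branch_value lm) w)%E by exact: esum_ge0.
under eq_integral do rewrite random_stepE.
rewrite ge0_integralD//; last 2 first.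
- by move=> w _; rewrite !adde_ge0.
- by apply: emeasurable_funD => //; exact: emeasurable_funD.
rewrite ge0_integralD//; last 2 first.
- by move=> w _; rewrite adde_ge0.
- exact: emeasurable_funD.
rewrite ge0_integralD// expectation_initial expectation_flip expectation_branch.
rewrite expectation_death /picard -2!addeA; congr (_ + _)%E.
have mQ : measurable_fun `[0, t] branch_sum.
  apply: measurable_fun_esum => [lm|lm s /=].
    by apply: measurable_funeM; exact: mvv.
  by rewrite in_itv/= => /andP[s0 _]; rewrite qvv0.
have Q0 s : 0 <= s -> (0 <= branch_sum s)%E.
  by move=> s0; apply: esum_ge0 => lm _; rewrite qvv0.
have mA : measurable_fun `[0, t] (fun s => (Cflip c * pflip c k)%:E * v k s)%E.
  by apply: measurable_funeM; exact: mv.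
have A0 s : 0 <= s -> (0 <= (Cflip c * pflip c k)%:E * v k s)%E.
  by move=> s0; rewrite mule_ge0 ?v0// lee_fin mulr_ge0.
have mBr : measurable_fun `[0, t] (fun s => (Cbranch c)%:E * branch_sum s)%E.
  exact: measurable_funeM.
have Br0 s : 0 <= s -> (0 <= (Cbranch c)%:E * branch_sum s)%E.
  by move=> s0; rewrite mule_ge0// Q0.
have mDe : measurable_fun `[0, t] (fun s => (pdeath c k * force k s)%:E).
  by apply/measurable_EFinP; apply: measurable_funM => //; exact: measurable_funTS.
have De0 s : (0 <= (pdeath c k * force k s)%:E)%E by rewrite lee_fin mulr_ge0.
have in0t s : `[0%R, t]%classic s -> 0 <= s by rewrite /= in_itv/= => /andP[].
have KA0 s : `[0%R, t]%classic s -> (0 <= K s * ((Cflip c * pflip c k)%:E * v k s))%E.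
  by move=> /in0t s0; apply: mule_ge0; [exact: K0|exact: A0].
have KB0 s : `[0%R, t]%classic s -> (0 <= K s * ((Cbranch c)%:E * branch_sum s))%E.
  by move=> /in0t s0; apply: mule_ge0; [exact: K0|exact: Br0].
have mKA := emeasurable_funM mK mA; have mKB := emeasurable_funM mK mBr.
have mKD := emeasurable_funM mK mDe.
have KD0 s : `[0%R, t]%classic s -> (0 <= K s * (pdeath c k * force k s)%:E)%E.
  by move=> _; exact: mule_ge0.
have KBD0 s : `[0%R, t]%classic s -> (0 <= K s * ((Cbranch c)%:E * branch_sum s) +
    K s * (pdeath c k * force k s)%:E)%E.
  by move=> s0; apply: adde_ge0; [exact: KB0|exact: KD0].
(* The integrand of [picard] is distributed into its flip, branch and death parts, to be matched
   with the three expectations. *)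
apply/esym; transitivity (\int[@lebesgue_measure R]_(s in `[0%R, t])
    (K s * ((Cflip c * pflip c k)%:E * v k s) +
     (K s * ((Cbranch c)%:E * branch_sum s) + K s * (pdeath c k * force k s)%:E)))%E.
  apply: eq_integral => s; rewrite inE => /in0t s0.
  rewrite -addeA ge0_muleDr ?ge0_muleDr//; [exact: Br0|exact: A0|].
  by apply: adde_ge0; [exact: Br0|exact: De0].
by rewrite ge0_integralD//; [rewrite ge0_integralD|exact: emeasurable_funD].
Qed.

End expectation_step.

(** * Expected evaluations and Picard iterates *)

Definition random_eval_upto n (a : label) (k : Zd d) (t : R) (w : Omega) : R :=
  eval_upto c (fun a => E a w) (fun a => U a w) (fun a => Y a ^~ w) init force n a k t.

Definition random_eval (a : label) (k : Zd d) (t : R) (w : Omega) : R :=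
  eval_at c (fun a => E a w) (fun a => U a w) (fun a => Y a ^~ w) init force a k t.

Definition picard_iter n : Zd d -> R -> \bar R := iter n picard (fun _ _ => 0%E).

Lemma adapted_eval_upto n : adapted (random_eval_upto n).
Proof.
elim: n => [|n IH]; first by move=> a k; exact: measurable_cst.
exact: (adapted_step IH).
Qed.

(** Nothing in the definition by choice shows measurability; it is inherited from the truncated
    evaluations as their pointwise limit. *)
Lemma adapted_eval : adapted random_eval.
Proof.
move=> a k.
apply: (@measurable_fun_cvg _ _ _ setT
  (fun n (x : R * Om (descendants a)) => random_eval_upto n a k x.1 x.2)).
  by move=> n; exact: adapted_eval_upto.
by move=> x _; exact: cvg_eval_upto.
Qed.

Lemma expectation_eval_upto n a k t : 0 <= t ->
  (\int[P]_w (random_eval_upto n a k t w)%:E = picard_iter n k t)%E.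
Proof.
elim: n a k t => [|n IH] a k t t0; first by rewrite integral0.
apply: (expectation_step (adapted_eval_upto n)) => // *.
exact: eval_upto_ge0.
Qed.

Let measurable_adapted W a k t : adapted W -> measurable_fun setT (W a k t).
Proof.
move=> adW.
have mp : measurable_fun setT (fun w : Omega => (t, w : Om (descendants a))).
  by apply: measurable_fun_pair => //; exact: (@measurable_id_Om (descendants a)).
exact: (measurableT_comp (adW a k) mp).
Qed.

Lemma measurable_random_eval a k t : measurable_fun setT (random_eval a k t).
Proof. exact: measurable_adapted adapted_eval. Qed.

Lemma random_eval_ge0 a k t w : 0 <= random_eval a k t w.
Proof. exact: eval_at_ge0. Qed.

(** Monotone convergence. The iterates do not mention [a], so the expected evaluation is the same at
    every label. *)
Lemma cvg_picard_iter a k t : 0 <= t ->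
  picard_iter n k t @[n --> \oo] --> (\int[P]_w (random_eval a k t w)%:E)%E.
Proof.
move=> t0.
have -> : (fun n => picard_iter n k t) =
    (fun n => \int[P]_w (random_eval_upto n a k t w)%:E)%E.
  by apply/funext => n; rewrite expectation_eval_upto.
have -> : (\int[P]_w (random_eval a k t w)%:E =
    \int[P]_w (limn (fun n => (random_eval_upto n a k t w)%:E)))%E.
  apply: eq_integral => w _; apply/esym/cvg_lim => //.
  by apply: cvg_EFin; [exact: nearW|exact: cvg_eval_upto].
apply: cvg_monotone_convergence => //.
- move=> n; apply/measurable_EFinP.
  exact: (measurable_adapted _ _ _ (adapted_eval_upto n)).
- by move=> n w _; rewrite lee_fin; exact: eval_upto_ge0.
- by move=> w _ m n mn; rewrite lee_fin; exact: eval_upto_nondecreasing.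
Qed.

(** The one-step identity is applied to the full evaluation, itself a fixed point of [step], so no
    limit is taken inside [picard]. *)
Lemma expectation_eval_picard k t : 0 <= t ->
  (\int[P]_w (random_eval [::] k t w)%:E =
   picard (fun l s => \int[P]_w (random_eval [::] l s w)%:E) k t)%E.
Proof.
move=> t0.
have -> : (\int[P]_w (random_eval [::] k t w)%:E =
    \int[P]_w (random_step random_eval [::] k t w)%:E)%E.
  by apply: eq_integral => w _; rewrite /random_eval eval_at_step.
apply: expectation_step => //; first exact: adapted_eval.
- by move=> *; exact: random_eval_ge0.
(* The expectations at [a] and at [[::]] are limits of the same iterates. *)
- move=> a l s s0; apply: (@cvg_unique _ _ (picard_iter n l s @[n --> \oo])) => //.
  + exact: cvg_picard_iter.
  + exact: cvg_picard_iter.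
Qed.

Lemma measurable_expectation_eval a k :
  measurable_fun setT (fun t => \int[P]_w (random_eval a k t w)%:E)%E.
Proof.
have mp : measurable_fun setT (fun x : R * Omega =>
    (x.1, x.2 : Om (descendants a))).
  apply: measurable_fun_pair => //.
  have mid := @measurable_id_Om (descendants a).
  exact: (measurableT_comp mid measurable_snd).
have mW : measurable_fun setT (fun x : R * Omega => (random_eval a k x.1 x.2)%:E).
  by apply/measurable_EFinP; exact: (measurableT_comp (@adapted_eval a k) mp).
apply: (@measurable_fun_fubini_tonelli_F _ _ _ _ _ P _ mW) => x.
by rewrite lee_fin random_eval_ge0.
Qed.

End tree_variables.

(** * Mild solutions *)

Lemma measurable_cnorm {R : realType} {r : nat} (D : set R) (f : R -> Cr R r) :
  measurable D ->
  (forall i, measurable_fun D (fun t => complex.Re (f t i 0)) /\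
             measurable_fun D (fun t => complex.Im (f t i 0))) ->
  measurable_fun D (fun t => cnorm (f t)).
Proof.
move=> mD mf; rewrite /cnorm; apply: (measurableT_comp (f := @Num.sqrt R)).
  by apply: continuous_measurable_fun; exact: sqrt_continuous.
apply: measurable_sum => i; have [mRe mIm] := mf i.
by apply: measurable_funD; exact: measurable_funX.
Qed.

Section cutoff.
Context {R : realType} {d r : nat} (gamma : Zd d -> R -> Cr R r) (T : R).

(* Nothing is known on gamma outside [0, T], not even its measurability. *)
Definition cutoff_norm (k : Zd d) (s : R) : R :=
  if 0 <= s <= T then cnorm (gamma k s) else 0.

Lemma cutoff_norm_ge0 k s : 0 <= cutoff_norm k s.
Proof. by rewrite /cutoff_norm; case: ifP => // _; exact: cnorm_ge0. Qed.

Lemma cutoff_normE k s : 0 <= s <= T -> cutoff_norm k s = cnorm (gamma k s).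
Proof. by rewrite /cutoff_norm => ->. Qed.

Lemma measurable_cutoff_norm k : in_Linfty_linfty T gamma ->
  measurable_fun setT (cutoff_norm k).
Proof.
move=> [mg _]; apply: measurable_fun_if => //.
  by apply: measurable_and; exact: measurable_fun_ler.
rewrite (_ : _ `&` _ = `[0, T]%classic); last first.
  by apply/seteqP; split => s /=; rewrite in_itv/=; [move=> [_ ->]|move=> ->].
exact: measurable_cnorm.
Qed.

End cutoff.

Section negative_clocks.
Context {R : realType} {d r : nat} (c : constants R d r)
  {disp : measure_display} {Omega : measurableType disp}
  (P : probability Omega R) (E U : label -> {RV P >-> R})
  (Y : label -> Zd d -> Omega -> Zd d * Zd d).
Hypothesis hEUY : branching_variables c E U Y.

(* Off this null set all times at which gamma is evaluated lie in [0, T]. *)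
Definition negative_clock : set Omega := \bigcup_a (E a @^-1` `]-oo, 0[).

Let measurable_E_lt0 a : measurable (E a @^-1` `]-oo, 0[).
Proof. by rewrite -[_ @^-1` _]setTI; exact: measurable_funP. Qed.

Lemma measurable_negative_clock : measurable negative_clock.
Proof.
apply: countable_bigcupT_measurable => [|a]; first exact: countableP.
exact: measurable_E_lt0.
Qed.

Lemma negative_clock_null : P negative_clock = 0%E.
Proof.
apply/(negligibleP P measurable_negative_clock).
pose F n := if @unpickle label n is Some a then E a @^-1` `]-oo, 0[ else set0.
apply: (@negligibleS _ _ _ _ (\bigcup_n F n)).
  by move=> w [a _ Ea]; exists (pickle a) => //; rewrite /F pickleK.
apply: negligible_bigcup => n; rewrite /F; case: (unpickle n) => [a|]; last first.
  exact: negligible_set0.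
apply/negligibleP => //.
have := E_law hEUY a (measurable_itv `]-oo, 0[).
by rewrite exponential_prob_itvNyo// oppr0 expR0 subee.
Qed.

End negative_clocks.

(** * Positivity, monotonicity and continuity of the Picard map *)

Section picard_properties.
Context {R : realType} {d r : nat} (c : constants R d r).
Hypothesis hc : standing_assumptions c.
Variables (init : Zd d -> R) (force : Zd d -> R -> R).
Hypotheses (init_ge0 : forall k, 0 <= init k)
  (force_ge0 : forall k t, 0 <= force k t).
Implicit Types (v w : Zd d -> R -> \bar R) (k l : Zd d) (s t : R).
Local Open Scope ereal_scope.

Let branch_sum v k s := \esum_(lm in [set: Zd d * Zd d])
  ((qbranch c k lm.1 lm.2)%:E * (v lm.1 s * v lm.2 s)).

Let source v k s := (Cflip c * pflip c k)%:E * v k s +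
  (Cbranch c)%:E * branch_sum v k s + (pdeath c k * force k s)%:E.

Let qbranch_ge0 k (lm : Zd d * Zd d) : (0 <= qbranch c k lm.1 lm.2)%R.
Proof. by case/andP: (qbranch_01 hc k lm.1 lm.2). Qed.

Let pflip_ge0 k : (0 <= pflip c k)%R.
Proof. by case/andP: (pflip_01 hc k). Qed.

Let pdeath_ge0 k : (0 <= pdeath c k)%R.
Proof. by case/andP: (pdeath_01 hc k). Qed.

Let source_le v w k s : (forall l, 0 <= v l s) -> (forall l, v l s <= w l s) ->
  source v k s <= source w k s.
Proof.
move=> v0 vw; rewrite /source leeD2r//; apply: leeD.
  by rewrite lee_wpmul2l// lee_fin mulr_ge0// (Cflip_ge0 hc).
rewrite lee_wpmul2l ?lee_fin ?(Cbranch_ge0 hc)//; apply: le_esum => lm _.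
by rewrite lee_wpmul2l ?lee_fin ?qbranch_ge0// lee_pmul.
Qed.

Let source_ge0 v k s : (forall l, 0 <= v l s) -> 0 <= source v k s.
Proof.
move=> v0; rewrite /source !adde_ge0//.
- by rewrite mule_ge0// lee_fin mulr_ge0// (Cflip_ge0 hc).
- rewrite mule_ge0 ?lee_fin ?(Cbranch_ge0 hc)//; apply: esum_ge0 => lm _.
  by rewrite !mule_ge0 ?lee_fin ?qbranch_ge0.
- by rewrite lee_fin mulr_ge0.
Qed.

Let kernel_ge0 k t s : 0 <= (lambda c k * expR (- (lambda c k * (t - s))))%:E.
Proof. by rewrite lee_fin mulr_ge0 ?expR_ge0// ltW// (lambda_gt0 hc). Qed.

Lemma picard_ge0 v k t : (forall l s, (0 <= s <= t)%R -> 0 <= v l s) ->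
  0 <= picard c init force v k t.
Proof.
move=> v0; apply: adde_ge0; first by rewrite lee_fin mulr_ge0 ?expR_ge0.
apply: integral_ge0 => s; rewrite /= in_itv/= => st.
by apply: mule_ge0 => //; apply: source_ge0 => l; exact: v0.
Qed.

Lemma le_picard v w k t :
  (forall l s, (0 <= s <= t)%R -> 0 <= v l s) ->
  (forall l s, (0 <= s <= t)%R -> v l s <= w l s) ->
  picard c init force v k t <= picard c init force w k t.
Proof.
move=> v0 vw; apply: leeD => //; apply: ge0_le_integral_nonmeas => s.
  rewrite /= in_itv/= => st.
  by apply: mule_ge0 => //; apply: source_ge0 => l; exact: v0.
rewrite /= in_itv/= => st; apply: lee_wpmul2l => //.
by apply: source_le => l; [exact: v0|exact: vw].
Qed.

Hypothesis force_measurable : forall k, measurable_fun setT (force k).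

(** Finiteness at the final time controls all earlier times, since on [[0, t]] the two kernels
    differ by a factor independent of [s]. *)
Lemma continuous_picard v k (T : R) : (0 <= T)%R ->
  (forall l, measurable_fun `[0%R, T] (v l)) ->
  (forall l s, (0 <= s <= T)%R -> 0 <= v l s) ->
  picard c init force v k T < +oo ->
  {within `[0%R, T], continuous (fun t => fine (picard c init force v k t))}.
Proof.
move=> T0 mv v0 finT.
(* The kernel at time t is expR (lambda (T - t)) times the kernel at time T, so
   everything reduces to the primitive of one integrable function on [0, T]. *)
pose f s := (lambda c k * expR (- (lambda c k * (T - s))))%:E * source v k s.
have f0 s : (0 <= s <= T)%R -> 0 <= f s.
  by move=> sT; apply: mule_ge0 => //; apply: source_ge0 => l; exact: v0.
have mf : measurable_fun `[0%R, T] f.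
  apply: emeasurable_funM.
    apply/measurable_EFinP/measurable_funTS; apply: measurable_funM => //.
    apply: measurableT_comp => //; apply: measurableT_comp => //.
    by apply: measurable_funM => //; exact: measurable_funB.
  apply: emeasurable_funD; last first.
    by apply/measurable_EFinP/measurable_funTS; exact: measurable_funM.
  apply: emeasurable_funD; first exact: measurable_funeM.
  apply: measurable_funeM; apply: measurable_fun_esum => [lm|lm s].
    by apply: measurable_funeM; exact: emeasurable_funM.
  rewrite /= in_itv/= => sT.
  by apply: mule_ge0; [rewrite lee_fin qbranch_ge0|apply: mule_ge0; exact: v0].
have intfoo : \int[@lebesgue_measure R]_(s in `[0%R, T]) f s < +oo.
  apply: le_lt_trans finT; rewrite /picard leeDr//.
  by rewrite lee_fin mulr_ge0 ?expR_ge0.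
have intf : (@lebesgue_measure R).-integrable `[0%R, T] f.
  apply/integrableP; split => //.
  have -> : \int[@lebesgue_measure R]_(s in `[0%R, T]) `|f s| =
      \int[@lebesgue_measure R]_(s in `[0%R, T]) f s.
    apply: eq_integral => s; rewrite inE/= in_itv/= => sT.
    by rewrite gee0_abs// f0.
  exact: intfoo.
(* An integrable function is finite almost everywhere, so [f] may be replaced by a real function, as
   the continuity theorem for primitives asks. *)
pose g s := fine (f s).
have mg : measurable_fun `[0%R, T] g.
  exact: (measurableT_comp (fine_measurable measurableT) mf).
have fg t : (0 <= t <= T)%R -> \int[@lebesgue_measure R]_(s in `[0%R, t]) f s =
    \int[@lebesgue_measure R]_(s in `[0%R, t]) (g s)%:E.
  move=> /andP[t0 tT].
  have sub : `[0%R, t]%classic `<=` `[0%R, T]%classic.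
    by apply: subset_itvl; rewrite bnd_simp.
  apply: ge0_ae_eq_integral => //.
  - exact: measurable_funS mf.
  - by apply/measurable_EFinP; exact: measurable_funS mg.
  - by move=> s /sub; rewrite /= in_itv/=; exact: f0.
  - by move=> s /sub; rewrite /= in_itv/= => /f0 h; rewrite lee_fin fine_ge0.
  - have mI : measurable (`[0%R, T]%classic : set (measurableTypeR R)) by [].
    have [N [mN N0 fN]] := integrable_ae mI intf.
    exists N; split => // s /= /not_implyP[/sub sT fs]; apply: fN => /= h.
    by apply: fs; rewrite /g fineK// h.
have intg : (@lebesgue_measure R).-integrable `[0%R, T] (EFin \o g).
  apply/integrableP; split; first exact/measurable_EFinP.
  have -> : \int[@lebesgue_measure R]_(s in `[0%R, T]) `|(EFin \o g) s| =
      \int[@lebesgue_measure R]_(s in `[0%R, T]) f s.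
    rewrite fg ?T0 ?lexx//; apply: eq_integral => s; rewrite inE/= in_itv/= => sT.
    by rewrite ger0_norm// fine_ge0// f0.
  exact: intfoo.
have fin_g t : (0 <= t <= T)%R ->
    \int[@lebesgue_measure R]_(s in `[0%R, t]) (g s)%:E =
    (parameterized_integral (@lebesgue_measure R) 0 t g)%:E.
  move=> /andP[t0 tT]; rewrite /parameterized_integral /Rintegral fineK//.
  apply: integrable_fin_num => //; apply: integrableS intg => //.
  by apply: subset_itvl; rewrite bnd_simp.
have picardE t : (0 <= t <= T)%R -> fine (picard c init force v k t) =
   (expR (- (lambda c k * t)) * init k + expR (lambda c k * (T - t)) *
     parameterized_integral (@lebesgue_measure R) 0 t g)%R.
  move=> tT; rewrite [picard _ _ _ _ _ _](_ : _ =
      (expR (- (lambda c k * t)) * init k)%:E + (expR (lambda c k * (T - t)))%:E *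
      \int[@lebesgue_measure R]_(s in `[0%R, t]) f s); first by rewrite fg// fin_g.
  congr (_ + _); have sub : `[0%R, t]%classic `<=` `[0%R, T]%classic.
    by case/andP: tT => *; apply: subset_itvl; rewrite bnd_simp.
  rewrite -ge0_integralZl//; last 2 first.
  - exact: measurable_funS mf.
  - by move=> s /sub; rewrite /= in_itv/=; exact: f0.
  apply: eq_integral => s _; rewrite /f muleA -EFinM; congr (_%:E * _).
  by rewrite mulrCA -expRD; congr (_ * expR _)%R; ring.
have ci := parameterized_integral_continuous T0 intg.
apply: (@subspace_eq_continuous _ _ _ (fun t => expR (- (lambda c k * t)) * init k +
   expR (lambda c k * (T - t)) * parameterized_integral (@lebesgue_measure R) 0 t g)%R).
  by move=> t; rewrite inE/= in_itv/= => tT; exact/esym/picardE.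
have clin (a b : R) : {within `[0%R, T], continuous (fun t : R => expR (a * t + b))}.
  apply: continuous_subspaceT => x.
  apply: (@continuous_comp _ _ _ (fun t => (a * t + b)%R)); last exact: continuous_expR.
  by apply: cvgD; [apply: cvgM; [exact: cvg_cst|exact: cvg_id]|exact: cvg_cst].
have c1 : {within `[0%R, T], continuous (fun t : R => expR (- (lambda c k * t)))}.
  rewrite (_ : (fun t => _) = (fun t => expR (- lambda c k * t + 0)%R)).
    exact: clin.
  by apply/funext => t; congr expR; ring.
have c2 : {within `[0%R, T], continuous (fun t : R => expR (lambda c k * (T - t)))}.
  rewrite (_ : (fun t => _) = (fun t => expR (- lambda c k * t + lambda c k * T)%R)).
    exact: clin.
  by apply/funext => t; congr expR; ring.
move=> x; apply: cvgD.
- by apply: cvgM; [exact: c1|exact: cvg_cst].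
- by apply: cvgM; [exact: c2|exact: ci].
Qed.

End picard_properties.

Section mild_solutions.
Context {R : realType} {d r : nat} (c : constants R d r).
Hypothesis hc : standing_assumptions c.
Variables (chi0 : Zd d -> Cr R r) (gamma : Zd d -> R -> Cr R r) (T : R).
Local Notation init := (fun k => cnorm (chi0 k)).
Local Notation force := (cutoff_norm gamma T).
Local Notation phi := (picard c init force).

Let init_ge0 k : 0 <= init k. Proof. exact: cnorm_ge0. Qed.

Lemma picard_mildE (v : Zd d -> R -> \bar R) (chi : Zd d -> R -> R) k t :
  0 <= t <= T -> (forall l s, 0 <= s <= T -> v l s = (chi l s)%:E) ->
  phi v k t = ((expR (- (lambda c k * t)) * cnorm (chi0 k))%:E +
     \int[@lebesgue_measure R]_(s in `[0%R, t])
       ((lambda c k * expR (- (lambda c k * (t - s))))%:E *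
        ((Cflip c * pflip c k * chi k s)%:E +
         (Cbranch c)%:E *
           (\esum_(lm in [set: Zd d * Zd d])
              (qbranch c k lm.1 lm.2 * chi lm.1 s * chi lm.2 s)%:E) +
         (pdeath c k * cnorm (gamma k s))%:E)))%E.
Proof.
move=> /andP[t0 tT] vE; congr (_ + _)%E; apply: eq_integral => s.
rewrite inE/= in_itv/= => /andP[s0 st].
have sT : 0 <= s <= T by rewrite s0 (le_trans st).
rewrite vE// -EFinM cutoff_normE//; congr (_ * (_ + _ * _ + _))%E.
by apply: eq_esum => lm _; rewrite !vE// -!EFinM mulrA.
Qed.

(** The mild solution is a fixed point of a monotone map. Nonnegativity travels in the same
    induction because the quadratic term is monotone only on nonnegative arguments. *)
Lemma picard_iter_le_mild_solution (chi : Zd d -> R -> R) n k t :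
  mild_solution c chi0 gamma T chi -> 0 <= t <= T ->
  (0 <= picard_iter c init force n k t <= (chi k t)%:E)%E.
Proof.
move=> mchi; elim: n k t => [|n IH] k t tT.
  by rewrite lexx lee_fin; have [_ h _] := mchi k; exact: h.
have sT s : 0 <= s <= t -> 0 <= s <= T.
  by case/andP: tT => _ tT /andP[-> /le_trans ->].
have [_ _ eqn] := mchi k.
rewrite eqn// -(picard_mildE (v := fun l s => (chi l s)%:E))//; apply/andP; split.
  apply: (picard_ge0 hc init_ge0 (cutoff_norm_ge0 gamma T)).
  by move=> l s /sT sT'; case/andP: (IH l s sT').
apply: (le_picard hc init (cutoff_norm_ge0 gamma T)) => l s /sT sT'.
  by case/andP: (IH l s sT').
by case/andP: (IH l s sT').
Qed.

End mild_solutions.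

Section expected_evaluation.
Context {R : realType} {d r : nat} (c : constants R d r).
Hypothesis hc : standing_assumptions c.
Context {disp : measure_display} {Omega : measurableType disp}
  (P : probability Omega R) (E U : label -> {RV P >-> R})
  (Y : label -> Zd d -> Omega -> Zd d * Zd d).
Hypothesis hEUY : branching_variables c E U Y.
Variables (chi0 : Zd d -> Cr R r) (gamma : Zd d -> R -> Cr R r) (T : R).
Hypothesis hgamma : in_Linfty_linfty T gamma.
Local Notation init := (fun k => cnorm (chi0 k)).
Local Notation force := (cutoff_norm gamma T).

Let init_ge0 k : 0 <= init k. Proof. exact: cnorm_ge0. Qed.

Lemma Rtilde_random_tree k t w :
  Rtilde c chi0 gamma t (random_tree c E U Y k w) =
  eval_at c (fun a => E a w) (fun a => U a w) (fun a => Y a ^~ w)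
    init (fun k s => cnorm (gamma k s)) [::] k t.
Proof.
rewrite /Rtilde /eval_at /tree_at /random_tree.
have E0 S (f : label -> S) : (fun b => f (b ++ [::])) = f.
  by apply/funext => b; rewrite cats0.
by rewrite (E0 _ (fun a => E a w)) (E0 _ (fun a => U a w)) (E0 _ (fun a => Y a ^~ w)).
Qed.

(** The two integrands agree unless some clock is negative, a null event. Only the one with the
    cutoff forcing is known to be measurable. *)
Lemma tree_expectation_Rtilde k t : 0 <= t <= T ->
  tree_expectation c E U Y k (Rtilde c chi0 gamma t) =
  (\int[P]_w (random_eval c E U Y init force [::] k t w)%:E)%E.
Proof.
move=> /andP[t0 tT]; rewrite /tree_expectation unlock.
apply: (ge0_eq_integral_off_null (measurable_negative_clock E)
  (negative_clock_null hEUY)).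
- move=> w; rewrite Rtilde_random_tree lee_fin.
  by apply: eval_at_ge0 => // *; exact: cnorm_ge0.
- move=> w; rewrite lee_fin.
  exact: (random_eval_ge0 hc E U Y init_ge0 (cutoff_norm_ge0 gamma T)).
- apply/measurable_EFinP.
  have mforce l : measurable_fun setT (force l) by exact: measurable_cutoff_norm.
  exact: (measurable_random_eval hEUY init mforce).
- move=> w wN; rewrite Rtilde_random_tree; congr _%:E.
  apply: (@eval_at_eq_force _ _ _ _ _ _ _ _ _ _ T) => //.
    move=> b; rewrite leNgt; apply/negP => Eb; apply: wN; exists b => //.
  by move=> l s sT; rewrite cutoff_normE.
Qed.

End expected_evaluation.

Theorem theorem4p1 (R : realType) (d r : nat) (d_ge1 : (1 <= d)%N)
    (r_ge1 : (1 <= r)%N)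
    (c : constants R d r) (hc : standing_assumptions c)
    (disp : measure_display) (Omega : measurableType disp)
    (P : probability Omega R)
    (E U : label -> {RV P >-> R}) (Y : label -> Zd d -> Omega -> Zd d * Zd d)
    (hEUY : branching_variables c E U Y)
    (T : R) (T_gt0 : 0 < T)
    (chi0 : Zd d -> Cr R r) (hchi0 : in_linfty chi0)
    (gamma : Zd d -> R -> Cr R r) (hgamma : in_Linfty_linfty T gamma) :
  let ER k t :=
    tree_expectation c E U Y k (fun tr => cnorm (Reval c chi0 gamma t tr)) in
  let ERtilde k t := tree_expectation c E U Y k (Rtilde c chi0 gamma t) in
  let ERtilde_finite := forall (t : R) (k : Zd d), 0 <= t <= T -> (ERtilde k t < +oo)%E in
  let chitilde k t := fine (ERtilde k t) in
  (ERtilde_finite ->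
     mild_solution c chi0 gamma T chitilde /\
     forall k, {within `[0, T], continuous (chitilde k)}) /\
  ((exists chi : Zd d -> R -> R, mild_solution c chi0 gamma T chi) ->
     ERtilde_finite /\
     mild_solution c chi0 gamma T chitilde /\
     (forall chi : Zd d -> R -> R, mild_solution c chi0 gamma T chi ->
        forall (k : Zd d) (t : R), 0 <= t <= T -> chitilde k t <= chi k t)) /\
  ((forall (k : Zd d) (t : R), 0 <= t <= T -> (ER k t <= ERtilde k t)%E) /\
   ((forall k l m u v, cnorm (Bmap c k l m u v) = cnorm u * cnorm v) ->
      forall (k : Zd d) (t : R), 0 <= t <= T -> ER k t = ERtilde k t)).
Proof.
move=> ER ERtilde ERtilde_finite chitilde.
pose init k := cnorm (chi0 k); pose force := cutoff_norm gamma T.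
have init_ge0 k : 0 <= init k by exact: cnorm_ge0.
have force_ge0 k s : 0 <= force k s by exact: cutoff_norm_ge0.
have mforce k : measurable_fun setT (force k) by exact: measurable_cutoff_norm.
(* Equal to [ERtilde] on [[0, T]], but nonnegative and measurable on the whole line, finite or
   not. *)
pose v k t := (\int[P]_w (random_eval c E U Y init force [::] k t w)%:E)%E.
have ERtildeE k t : 0 <= t <= T -> ERtilde k t = v k t.
  exact: tree_expectation_Rtilde.
have v0 k t : (0 <= v k t)%E.
  by apply: integral_ge0 => w _; rewrite lee_fin; exact: random_eval_ge0.
have mv k : measurable_fun setT (v k).
  exact: (measurable_expectation_eval hc hEUY init_ge0 force_ge0 mforce).
have v_picard k t : 0 <= t -> v k t = picard c init force v k t.
  exact: (expectation_eval_picard hc hEUY init_ge0 force_ge0 mforce).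
have fin_mild : ERtilde_finite ->
    mild_solution c chi0 gamma T chitilde /\
    forall k, {within `[0, T], continuous (chitilde k)}.
  move=> fin.
  have chiE k t : 0 <= t <= T -> v k t = (chitilde k t)%:E.
    move=> tT; rewrite /chitilde fineK ?ERtildeE//.
    by rewrite ge0_fin_numE// -ERtildeE//; exact: fin.
  split=> k.
    split.
    - apply: (eq_measurable_fun (fine \o v k)).
        by move=> t; rewrite inE/= in_itv/= => tT; rewrite chiE.
      apply: (measurableT_comp (fine_measurable measurableT)).
      exact: measurable_funTS.
    - by move=> t tT; rewrite -lee_fin -chiE.
    - move=> t tT; rewrite -chiE// v_picard; last by case/andP: tT.
      exact: picard_mildE.
  have T0 : 0 <= T by exact: ltW.
  have TT : 0 <= T <= T by rewrite T0 lexx.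
  (* By the fixed point equation, continuity is that of a Picard image. *)
  apply: (@subspace_eq_continuous _ _ _ (fun t => fine (picard c init force v k t))).
    move=> t; rewrite inE/= in_itv/= => tT.
    rewrite -v_picard; last by case/andP: tT.
    by rewrite chiE.
  apply: continuous_picard => //.
  - by move=> l; exact: measurable_funTS.
  - by rewrite -v_picard// -ERtildeE//; exact: fin.
have v_le chi : mild_solution c chi0 gamma T chi ->
    forall k t, 0 <= t <= T -> (v k t <= (chi k t)%:E)%E.
  move=> mchi k t tT; have /andP[t0 _] := tT.
  have cv := cvg_picard_iter hc hEUY init_ge0 force_ge0 mforce (a := [::]) (k := k) t0.
  rewrite /v -(cvg_lim _ cv)//; apply: lime_le.
    by apply/cvg_ex; eexists; exact: cv.
  by apply: nearW => n; have /andP[] := picard_iter_le_mild_solution hc n k mchi tT.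
split; first exact: fin_mild.
split.
  move=> [chi mchi].
  have fin : ERtilde_finite.
    by move=> t k tT; rewrite ERtildeE// (le_lt_trans (v_le _ mchi _ _ tT))// ltry.
  split=> //; split; first by have [] := fin_mild fin.
  move=> chi' mchi' k t tT; rewrite -lee_fin /chitilde fineK ?ERtildeE//.
    exact: v_le.
  by rewrite ge0_fin_numE// -ERtildeE//; exact: fin.
split=> [k t tT|BE k t tT]; rewrite /ER /ERtilde /tree_expectation unlock.
  (* The pointwise comparison is integrated without any measurability of the evaluations. *)
  apply: ge0_le_integral_nonmeas => w _; rewrite lee_fin; first exact: cnorm_ge0.
  exact: cnorm_Reval_le.
by apply: eq_integral => w _; rewrite cnorm_RevalE.
Qed.
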